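(* Let $\mathfrak X_0$ be an integral normal scheme of finite type over $\mathrm{Spec}\,\mathbb Z$ with function field $K_0$. If $\dim\mathfrak X_0\ge2$, or if $\dim\mathfrak X_0=1$ and $\mathrm{char}\,K_0>0$, assume that the Claim $(\ast)$ stated in the context holds. Then $$\overline{\check{\mathfrak X}(\mathbb C)_{\mathrm{per}}}=\check{\mathfrak X}(S^1)\quad\text{and}\quad\overline{\check{\mathfrak X}_0(\mathbb C)_{\mathrm{per}}}=\check{\mathfrak X}_0(S^1),$$ where the closures are taken in $\check{\mathfrak X}(\mathbb C)$ and $\check{\mathfrak X}_0(\mathbb C)$ respectively.
   Context: Claim $(\ast)$: Let $A$ be a finitely generated (over $\mathbb Z$) integrally closed domain with quotient field $\kappa$ and let $x_1,\dots,x_n\in\kappa^\times$ be elements whose images in $\kappa^\times\otimes\mathbb Q$ are $\mathbb Q$-linearly independent. Let $N\ge1$ be an integer prime to $\mathrm{char}\,\kappa$, $l\nmid N$ a prime with $l\neq\mathrm{char}\,\kappa$, and $\nu_1,\dots,\nu_n\ge1$ integers. Then there exists a maximal ideal $\mathfrak n$ of $A$ such that: 1) $N\notin\mathfrak n$ and $l\notin\mathfrak n$; 2) $x_1,\dots,x_n\in A_{\mathfrak n}\setminus\mathfrak nA_{\mathfrak n}$ and the orders $o(\bar x_j)$ of $\bar x_j=x_j\bmod\mathfrak nA_{\mathfrak n}$ in $(A_{\mathfrak n}/\mathfrak nA_{\mathfrak n})^\times$ are prime to $N$ for $1\le j\le n$; 3) $\mathrm{ord}_l(o(\bar x_j))=\nu_j$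 for $1\le j\le n$. Let $K$ be an algebraic closure of $K_0$, $\pi:\mathfrak X\to\mathfrak X_0$ the normalization of $\mathfrak X_0$ in $K$, $G=\mathrm{Aut}_{K_0}(K)$, acting on $\mathfrak X$ from the right over $\mathfrak X_0$ (with induced isomorphisms $\sigma:\kappa(x^\sigma)\to\kappa(x)$). $\mathcal N$ is the multiplicative monoid of positive integers. $\dot{\mathfrak X}(\mathbb C)$ is the set of pairs $(x,\bar P^\times)$, $x\in\mathfrak X$, $\bar P^\times:\kappa(x)^\times\to\mathbb C^\times$ a group homomorphism, with $(x,\bar P^\times)^\sigma=(x^\sigma,\bar P^\times\circ\sigma)$ for $\sigma\in G$ and injective maps $F_\nu(x,\bar P^\times)=(x,\bar P^\times\circ(\ )^\nu)$, $\nu\in\mathcal N$. $\check{\mathfrak X}(\mathbb C)=\mathrm{colim}_{\mathcal N}\dot{\mathfrak X}(\mathbb C)$ (over $\mathcal N$ ordered by divisibility, transition map from index $\nu$ to $\nu\mu$ being $F_\mu$), on which each $F_\nu$ is bijective; $\check{\mathfrak X}_0(\mathbb C)=\check{\mathfrak X}(\mathbb C)/G$. $\dot{\mathfrak X}(\mathbb C)_{\mathrm{per}}=\{(x,\bar P^\times)\in\dot{\mathfrak X}(\mathbb C)\mid\kappa(x)\cong\overline{\mathbb F}_p\text{ for some prime }p\text{ and }\ker\bar P^\times\text{ is finite}\}$; $\dot{\mathfrak X}(S^1)=\{(x,\bar P^\times)\in\dot{\mathfrak X}(\mathbb C)\mid\bar P^\times(\kappa(x)^\times)\subset S^1\}$,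 $S^1\subset\mathbb C^\times$ the unit circle. $\check{\mathfrak X}(\mathbb C)_{\mathrm{per}}$ and $\check{\mathfrak X}(S^1)$ are the corresponding colimits over $\mathcal N$, viewed as subsets of $\check{\mathfrak X}(\mathbb C)$, and $\check{\mathfrak X}_0(\mathbb C)_{\mathrm{per}}=\check{\mathfrak X}(\mathbb C)_{\mathrm{per}}/G$, $\check{\mathfrak X}_0(S^1)=\check{\mathfrak X}(S^1)/G$. Topologies: if $\mathfrak X_0=\mathrm{Spec}\,R_0$ is affine, $\mathfrak X=\mathrm{Spec}\,R$, identify $(x,\bar P^\times)$, $x$ corresponding to the prime $\mathfrak p$, with the multiplicative map $P:R\to\mathbb C$, $P(r)=\bar P^\times(r\bmod\mathfrak p)$ for $r\notin\mathfrak p$ and $P(r)=0$ for $r\in\mathfrak p$, and give $\dot{\mathfrak X}(\mathbb C)$ the topology of pointwise convergence. In general $O\subset\dot{\mathfrak X}(\mathbb C)$ is open iff its intersection with $\{(x,\bar P^\times)\mid x\in\pi^{-1}(\mathfrak X_0')\}$ is open there for every affine open $\mathfrak X_0'\subset\mathfrak X_0$. $\check{\mathfrak X}(\mathbb C)$ has the inductive limit topology ($Z$ is open iff $F_\nu(Z)\cap\dot{\mathfrak X}(\mathbb C)$ is open in $\dot{\mathfrak X}(\mathbb C)$ for all $\nu\in\mathcal N$) and $\check{\mathfrak X}_0(\mathbb C)$ the quotient topology. *)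

(* Defs.v *)
From HB Require Import structures.
From Stdlib Require Import Relations.
From mathcomp Require Import all_boot all_order all_algebra.
From mathcomp Require Import all_classical all_reals all_analysis.
From mathcomp Require Import complex.
Import Order.TTheory GRing.Theory Num.Theory.
Import numFieldNormedType.Exports.

Set Implicit Arguments.
Unset Strict Implicit.
Unset Printing Implicit Defensive.

Local Open Scope classical_set_scope.
Local Open Scope ring_scope.
Local Open Scope quotient_scope.

(* Rings of sections may be zero, hence [comPzRingType]; MathComp's
   [idealr_closed] requires a nontrivial ring. *)
Definition is_ideal (A : comPzRingType) (I : set A) : Prop :=
  [/\ I 0, forall a b, I a -> I b -> I (a + b) & forall a b, I b -> I (a * b)].

Definition is_prime_ideal (A : comPzRingType) (p : set A) : Prop :=
  [/\ is_ideal p, ~ p 1 & forall a b, p (a * b) -> p a \/ p b].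

Definition is_maximal_ideal (A : comPzRingType) (m : set A) : Prop :=
  [/\ is_ideal m, ~ m 1 &
      forall J : set A, is_ideal J -> ~ J 1 -> m `<=` J -> J = m].

Definition fg_ring (A : comPzRingType) : Prop :=
  exists s : seq A, forall S : {pred A},
    GRing.subring_closed S -> {subset s <= S} -> forall a, a \in S.

Definition integral_over (K : fieldType) (S : set K) (z : K) : Prop :=
  exists p : {poly K}, [/\ p \is monic, forall i, S p`_i & root p z].

Definition is_algebraic_closure (F K : fieldType) (f : {rmorphism F -> K}) :
    Prop :=
  GRing.closed_field_axiom K /\ integralRange f.

(* Group homomorphisms from the multiplicative group of [k]; the value at [0]
   is irrelevant. *)
Definition units_hom (k : fieldType) (V : zmodType) (f : k -> V) : Prop :=
  forall a b, a != 0 -> b != 0 -> f (a * b) = f a + f b.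

(* [V], together with [t : u |-> u (x) 1], is the extension of scalars to Q of
   the abelian group of units of [k]. *)
Definition is_units_tensorQ (k : fieldType) (V : lmodType rat) (t : k -> V) :
    Prop :=
  units_hom t /\
  forall (W : lmodType rat) (f : k -> W), units_hom f ->
    exists g : {linear V -> W},
      (forall a, a != 0 -> g (t a) = f a) /\
      (forall g' : {linear V -> W},
         (forall a, a != 0 -> g' (t a) = f a) -> forall v, g' v = g v).

Definition units_tensorQ_free (k : fieldType) (n : nat) (x : 'I_n -> k) :
    Prop :=
  exists (V : lmodType rat) (t : k -> V), is_units_tensorQ t /\
    forall q : 'I_n -> rat, \sum_j q j *: t (x j) = 0 -> forall j, q j = 0.

(* The localization at a prime ideal and its maximal ideal, as subsets of the
   fraction field. *)
Definition loc_ring (A : idomainType) (p : set A) : set {fraction A} :=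
  [set z | exists a b : A, ~ p b /\ z = tofrac a / tofrac b].

Definition loc_max (A : idomainType) (p : set A) : set {fraction A} :=
  [set z | exists a b : A, [/\ p a, ~ p b & z = tofrac a / tofrac b]].

(* [d] is the order of the class of [x] in the units of the residue field. *)
Definition is_residue_order (A : idomainType) (p : set A) (x : {fraction A})
    (d : nat) : Prop :=
  [/\ (0 < d)%N, loc_max p (x ^+ d - 1) &
      forall k, (0 < k)%N -> loc_max p (x ^+ k - 1) -> (d <= k)%N].

(* In characteristic zero every [N] is prime to the characteristic. *)
Definition reduction_orders_claim : Prop :=
  forall (A : idomainType) (n : nat) (x : 'I_n -> {fraction A})
         (N l : nat) (nu : 'I_n -> nat),
  fg_ring A ->
  (forall z, integralOver (@tofrac A) z -> exists a, z = tofrac a) ->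
  (forall j, x j != 0) ->
  units_tensorQ_free x ->
  (0 < N)%N -> (forall p, p \in [pchar {fraction A}] -> coprime N p) ->
  prime l -> ~~ (l %| N)%N -> l \notin [pchar {fraction A}] ->
  (forall j, (0 < nu j)%N) ->
  exists m : set A, is_maximal_ideal m /\
    [/\ ~ m N%:R, ~ m l%:R &
        forall j, [/\ loc_ring m (x j), ~ loc_max m (x j) &
          exists d, [/\ is_residue_order m (x j) d, coprime d N &
                        logn l d = nu j]]].

Record opens (T : topologicalType) :=
  Opens { oset :> set T; oset_open : open oset }.

Identity Coercion set_Funclass : set >-> Funclass.

(* A locally ringed space.  Instead of the local ring at [x] we record its
   residue field [kappa x] together with the evaluation of sections at [x]:
   [ev_surj] and [ev_unit] say that [kappa x] is the quotient of the stalk at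
   [x] by an ideal whose complement consists of units, i.e. that the stalk is
   local with residue field [kappa x]. *)
Record lrspace := Lrspace {
  lrs_pt :> topologicalType;
  sec : opens lrs_pt -> comPzRingType;
  res : forall U V : opens lrs_pt, V `<=` U -> {rmorphism sec U -> sec V};
  res_id : forall (U : opens lrs_pt) (h : U `<=` U) (s : sec U), res h s = s;
  res_comp : forall (U V W : opens lrs_pt)
    (VU : V `<=` U) (WV : W `<=` V) (WU : W `<=` U) (s : sec U),
    res WV (res VU s) = res WU s;
  sec_glue : forall (U : opens lrs_pt) (I : Type) (V : I -> opens lrs_pt)
    (VU : forall i, V i `<=` U), U `<=` \bigcup_i V i ->
    forall s : (forall i, sec (V i)),
    (forall i j (W : opens lrs_pt) (Wi : W `<=` V i) (Wj : W `<=` V j),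
       res Wi (s i) = res Wj (s j)) ->
    exists! t : sec U, forall i, res (VU i) t = s i;
  kappa : lrs_pt -> fieldType;
  ev : forall (U : opens lrs_pt) (x : lrs_pt),
    U x -> {rmorphism sec U -> kappa x};
  ev_res : forall (U V : opens lrs_pt) (VU : V `<=` U) (x : lrs_pt)
    (Vx : V x) (s : sec U), ev Vx (res VU s) = ev (VU x Vx) s;
  ev_surj : forall (x : lrs_pt) (a : kappa x),
    exists (U : opens lrs_pt) (Ux : U x) (s : sec U), ev Ux s = a;
  ev_unit : forall (U : opens lrs_pt) (x : lrs_pt) (Ux : U x) (s : sec U),
    ev Ux s != 0 ->
    exists (V : opens lrs_pt) (VU : V `<=` U),
      V x /\ exists t : sec V, res VU s * t = 1
}.

Definition vanishing (X : lrspace) (U : opens X) (x : X) (Ux : U x) :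
    set (sec U) :=
  [set s | ev Ux s = 0].

Definition nonvanishing (X : lrspace) (U : opens X) (s : sec U) : set X :=
  [set x | exists Ux : U x, ev Ux s != 0].

(* The canonical morphism from [U] to the spectrum of the ring of sections over
   [U] sends [x] to [vanishing x].  [U] is affine iff it is an isomorphism: it
   is bijective, it is a homeomorphism (the preimages of the principal open
   sets form a basis of [U]), and over the principal open set of [s] it
   identifies the sections with the localization at [s]. *)
Definition is_affine (X : lrspace) (U : opens X) : Prop :=
  [/\ forall p : set (sec U), is_prime_ideal p ->
        exists (x : X) (Ux : U x), vanishing Ux = p,
      forall (x y : X) (Ux : U x) (Uy : U y),
        vanishing Ux = vanishing Uy -> x = y,
      forall (V : opens X) (x : X), V `<=` U -> V x ->
        exists s : sec U, nonvanishing s x /\ nonvanishing s `<=` V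
    & forall (s : sec U) (D : opens X) (DU : D `<=` U),
        oset D = nonvanishing s ->
        (forall t : sec D, exists (a : sec U) (n : nat),
           res DU a = res DU s ^+ n * t) /\
        (forall a : sec U, res DU a = 0 -> exists n : nat, s ^+ n * a = 0)].

Record scheme := Scheme {
  sch :> lrspace;
  sch_affine : forall x : sch, exists U : opens sch, U x /\ is_affine U
}.

Definition preim (X Y : topologicalType) (f : X -> Y) (fc : continuous f)
    (U : opens Y) : opens X :=
  Opens (open_comp (fun x _ => fc x) (oset_open U)).

(* Locality of a morphism is expressed by the induced maps of residue fields. *)
Record morphism (X Y : lrspace) := Morphism {
  mor :> X -> Y;
  mor_cont : continuous mor;
  mor_sec : forall U : opens Y, {rmorphism sec U -> sec (preim mor_cont U)};
  mor_res : forall (U V : opens Y) (VU : V `<=` U)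
    (VU' : preim mor_cont V `<=` preim mor_cont U) (s : sec U),
    mor_sec V (res VU s) = res VU' (mor_sec U s);
  mor_kappa : forall x : X, {rmorphism kappa (mor x) -> kappa x};
  mor_ev : forall (U : opens Y) (x : X) (Ux : U (mor x)) (s : sec U),
    ev (U := preim mor_cont U) Ux (mor_sec U s) = mor_kappa x (ev Ux s)
}.
Arguments mor_cont {X Y} m.

Definition is_integral (X : scheme) : Prop :=
  (exists x : X, True) /\
  forall U : opens X, (exists x, U x) ->
    (1 : sec U) != 0 /\ forall s t : sec U, s * t = 0 -> s = 0 \/ t = 0.

(* The function field of an integral scheme with generic point [eta] is the
   local ring at [eta]; being a field, it equals [kappa eta]. *)
Definition is_generic_point (X : scheme) (eta : X) : Prop :=
  closure [set eta] = setT.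

(* The local ring at [x], as a subring of the function field. *)
Definition local_ring (X : scheme) (eta x : X) : set (kappa eta) :=
  [set z | exists U : opens X, U x /\
             exists (Ueta : U eta) (s : sec U), ev Ueta s = z].
Arguments local_ring {X} eta x _.

Definition is_normal (X : scheme) (eta : X) : Prop :=
  forall (x : X) (z : kappa eta),
    integral_over (local_ring eta x) z -> local_ring eta x z.

Definition finite_type_Z (X : scheme) : Prop :=
  exists (n : nat) (U : 'I_n -> opens X),
    (forall i, is_affine (U i) /\ fg_ring (sec (U i))) /\
    (forall x : X, exists i, U i x).

Definition irreducible_closed (T : topologicalType) (Z : set T) : Prop :=
  [/\ closed Z, Z !=set0 &
      forall A B : set T, closed A -> closed B ->
        Z `<=` A `|` B -> Z `<=` A \/ Z `<=` B].

Definition krull_dim_ge (T : topologicalType) (n : nat) : Prop :=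
  exists Z : nat -> set T,
    (forall i, (i <= n)%N -> irreducible_closed (Z i)) /\
    (forall i, (i < n)%N -> Z i `<` Z i.+1).

Definition krull_dim_eq (T : topologicalType) (n : nat) : Prop :=
  krull_dim_ge T n /\ ~ krull_dim_ge T n.+1.

(* The normalization of [X0] in an algebraic extension [K] of its function
   field [kappa eta0]: an integral scheme over [X0] with function field [K],
   affine over [X0], whose ring of functions over a nonempty affine open [U] of
   [X0] is the integral closure in [K] of the ring of functions on [U]. *)
Record normalization (X0 : scheme) (eta0 : X0) (K : fieldType)
    (iota : {rmorphism kappa eta0 -> K}) := Normalization {
  nrm :> scheme;
  nrm_pi : morphism nrm X0;
  nrm_eta : nrm;
  nrm_theta : {rmorphism kappa nrm_eta -> K};
  nrm_integral : is_integral nrm;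
  nrm_generic : is_generic_point nrm_eta;
  nrm_theta_bij : bijective nrm_theta;
  nrm_over : forall (U : opens X0) (U0 : U eta0) (U1 : U (nrm_pi nrm_eta))
    (s : sec U),
    nrm_theta (ev (U := preim (mor_cont nrm_pi) U) U1 (mor_sec nrm_pi U s)) =
    iota (ev U0 s);
  nrm_affine : forall U : opens X0, is_affine U ->
    is_affine (preim (mor_cont nrm_pi) U);
  nrm_closure : forall (U : opens X0) (U0 : U eta0) (z : K), is_affine U ->
    integral_over [set iota (ev U0 s) | s in [set: sec U]] z <->
    exists (U1 : U (nrm_pi nrm_eta))
           (s : sec (preim (mor_cont nrm_pi) U)),
      nrm_theta (ev (U := preim (mor_cont nrm_pi) U) U1 s) = z
}.

Section NormalizationTheory.
Context {X0 : scheme} {eta0 : X0} {K : fieldType}.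
Context {iota : {rmorphism kappa eta0 -> K}}.

Definition is_galois (sigma : {rmorphism K -> K}) : Prop :=
  bijective sigma /\ forall a, sigma (iota a) = iota a.

Variable X : normalization iota.

(* [g] is the endomorphism [x |-> x^sigma] of [X] over [X0]: on functions,
   viewed as elements of [K], it is [s |-> sigma s], so that on an affine piece
   [Spec R] it sends a prime to its preimage under [sigma], and [mor_kappa g x]
   is the isomorphism from [kappa (x^sigma)] to [kappa x]. *)
Definition is_galois_action (sigma : {rmorphism K -> K}) (g : morphism X X) :
    Prop :=
  (forall x : X, nrm_pi X (g x) = nrm_pi X x) /\
  (forall (U : opens X) (U0 : U (nrm_eta X)) (U1 : U (g (nrm_eta X)))
          (s : sec U),
     nrm_theta X (ev (U := preim (mor_cont g) U) U1 (mor_sec g U s)) =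
     sigma (nrm_theta X (ev U0 s))).

End NormalizationTheory.

(* The complex numbers with the topology given by the modulus. *)
Definition Cplx (R : realType) : numFieldType := R[i].

(* A homomorphism from the units of [k] to the units of [Cplx R], extended by
   [0] at [0]. *)
Record unit_char (R : realType) (k : fieldType) := UnitChar {
  uchar :> k -> Cplx R;
  uchar0 : uchar 0 = 0;
  uchar_mul : GRing.monoid_morphism uchar
}.

Lemma unit_char_eq (R : realType) (k : fieldType) (P Q : unit_char R k) :
  (forall a, P a = Q a) -> P = Q.
Proof.
case: P Q => [P P0 PM] [Q Q0 QM] /= PQ.
have eqPQ : P = Q by apply/funext.
by subst Q; congr UnitChar; exact: Prop_irrelevance.
Qed.

Definition uchar_comp (R : realType) (k k' : fieldType)
    (f : {rmorphism k' -> k}) (P : unit_char R k) : unit_char R k'.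
Proof.
refine (@UnitChar R k' (P \o f) _ _).
- by rewrite /= rmorph0 uchar0.
- have [PM P1] := (uchar_mul P).
  by split; [rewrite /= rmorph1 | move=> a b /=; rewrite rmorphM].
Defined.

Definition pos_nat := {n : nat | (0 < n)%N}.

Lemma pos_mul_gt0 (a b : pos_nat) : (0 < val a * val b)%N.
Proof. by rewrite muln_gt0 (valP a) (valP b). Qed.

Definition pos_mul (a b : pos_nat) : pos_nat :=
  exist (fun n : nat => 0 < n)%N (val a * val b)%N (pos_mul_gt0 a b).

Definition uchar_pow (R : realType) (k : fieldType) (nu : pos_nat)
    (P : unit_char R k) : unit_char R k.
Proof.
refine (@UnitChar R k (fun a => P (a ^+ val nu)) _ _).
- by rewrite expr0n -[_ == 0%N]negbK -lt0n (valP nu) uchar0.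
- have [P1 PM] := (uchar_mul P).
  by split; [rewrite expr1n | move=> a b; rewrite exprMn].
Defined.

Record dot_pt (R : realType) (X : lrspace) := DotPt {
  dpt : X;
  dchar : unit_char R (kappa dpt)
}.

Definition dot_frob (R : realType) (X : lrspace) (nu : pos_nat)
    (a : dot_pt R X) : dot_pt R X :=
  DotPt (uchar_pow nu (dchar a)).

Definition dot_act (R : realType) (X : lrspace) (g : morphism X X)
    (a : dot_pt R X) : dot_pt R X :=
  @DotPt R X (g (dpt a)) (uchar_comp (mor_kappa g (dpt a)) (dchar a)).

Lemma dot_frobM (R : realType) (X : lrspace) (m n : pos_nat)
    (a : dot_pt R X) :
  dot_frob m (dot_frob n a) = dot_frob (pos_mul m n) a.
Proof.
by case: a => x P; congr DotPt; apply: unit_char_eq => b /=; rewrite exprM.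
Qed.

Lemma pos_mulC (m n : pos_nat) : pos_mul m n = pos_mul n m.
Proof. by apply: val_inj; rewrite /= mulnC. Qed.

Section ComplexPoints.
Variable R : realType.
Context {X0 : scheme} {eta0 : X0} {K : fieldType}.
Context {iota : {rmorphism kappa eta0 -> K}}.
Variable X : normalization iota.

Definition dotX : Type := dot_pt R X.

HB.instance Definition _ := gen_eqMixin dotX.
HB.instance Definition _ := gen_choiceMixin dotX.

(* For [U] affine in [X0], a point [(x, P)] with [x] over [U] is identified
   with the map [r |-> P (r(x))] on the ring of functions over [U]. *)
Definition dot_open (O : set dotX) : Prop :=
  forall U : opens X0, is_affine U ->
    exists V : set {ptws sec (preim (mor_cont (nrm_pi X)) U) -> Cplx R},
      open V /\
      forall (a : dotX) (Ua : U (nrm_pi X (dpt a))),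
        O a <->
        V (fun r => dchar a (ev (U := preim (mor_cont (nrm_pi X)) U) Ua r)).

Lemma dot_openT : dot_open setT.
Proof. by move=> U _; exists setT; split => //; exact: openT. Qed.

Lemma dot_openI (A B : set dotX) :
  dot_open A -> dot_open B -> dot_open (A `&` B).
Proof.
move=> oA oB U Ua; have [V [oV VE]] := oA U Ua; have [W [oW WE]] := oB U Ua.
exists (V `&` W); split; first exact: openI.
by move=> a h; split=> -[] /=; rewrite /setI/=; split;
   [exact/VE|exact/WE|exact/(VE _ h)|exact/(WE _ h)].
Qed.

Lemma dot_open_bigU (I : Type) (F : I -> set dotX) :
  (forall i, dot_open (F i)) -> dot_open (\bigcup_i F i).
Proof.
move=> oF U Ua.
have /choice[V hV] := fun i => oF i U Ua.
exists (\bigcup_i V i); split; first by apply: bigcup_open => i _; case: (hV i).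
move=> a h; split=> -[i _ ai]; exists i => //; have [_ E] := hV i.
  exact/E.
exact/(E _ h).
Qed.

HB.instance Definition _ :=
  isOpenTopological.Build dotX dot_openT dot_openI dot_open_bigU.

(* The inductive limit over the positive integers ordered by divisibility, as a
   quotient of the disjoint union of the copies of [dotX].  The class of
   [(nu, a)] is the inverse image of the class of [(1, a)] under [F_nu], so a
   set [Z] is open for the quotient topology iff all
   [{a | [(nu, a)] \in Z}], i.e. all [F_nu(Z) `&` dotX], are open. *)
Definition pre_checkX : Type := {nu : pos_nat & dotX}.

HB.instance Definition _ := Topological.on pre_checkX.

Definition colim_eq (u v : pre_checkX) : Prop :=
  exists m n : pos_nat,
    pos_mul (projT1 u) m = pos_mul (projT1 v) n /\
    dot_frob m (projT2 u) = dot_frob n (projT2 v).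

Definition colim_rel : rel pre_checkX := fun u v => `[< colim_eq u v >].

Lemma colim_rel_equiv : equiv_class_of colim_rel.
Proof.
split.
- move=> u; apply/asboolP.
  by exists (exist _ 1%N isT), (exist _ 1%N isT).
- move=> u v; apply/asboolP/asboolP => -[m [n [e1 e2]]]; exists n, m; by split.
- move=> v u w /asboolP[a [b [e1 e2]]] /asboolP[c [d [e3 e4]]]; apply/asboolP.
  exists (pos_mul a c), (pos_mul d b); split.
  + apply: val_inj; move/(congr1 val): e1; move/(congr1 val): e3 => /= e3 e1.
    by rewrite mulnA e1 mulnA -e3 mulnAC.
  + by rewrite pos_mulC -dot_frobM e2 dot_frobM pos_mulC -dot_frobM e4
       dot_frobM pos_mulC.
Qed.

Canonical colim_equiv := EquivRelPack colim_rel_equiv.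

Definition checkX : Type := quotient_topology {eq_quot colim_equiv}.

HB.instance Definition _ := Topological.on checkX.

Definition to_checkX (nu : pos_nat) (a : dotX) : checkX :=
  \pi_{eq_quot colim_equiv} (existT (fun _ => dotX) nu a).

(* The colimit of a subset of [dotX], viewed as a subset of [checkX]. *)
Definition checkX_of (A : set dotX) : set checkX :=
  [set u | exists (nu : pos_nat) (a : dotX), A a /\ u = to_checkX nu a].

(* The quotient by the Galois group, i.e. by the equivalence relation
   identifying every point with its Galois translates. *)
Definition galois_step (u v : checkX) : Prop :=
  exists (sigma : {rmorphism K -> K}) (g : morphism X X),
    [/\ is_galois (iota := iota) sigma, is_galois_action sigma g &
        exists (nu : pos_nat) (a : dotX),
          u = to_checkX nu a /\ v = to_checkX nu (dot_act g a)].

Definition galois_rel : rel checkX :=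
  fun u v => `[< clos_refl_sym_trans checkX galois_step u v >].

Lemma galois_rel_equiv : equiv_class_of galois_rel.
Proof.
split.
- by move=> u; apply/asboolP; exact: rst_refl.
- by move=> u v; apply/asboolP/asboolP; exact: rst_sym.
- by move=> v u w /asboolP uv /asboolP vw; apply/asboolP; apply: rst_trans vw.
Qed.

Canonical galois_equiv := EquivRelPack galois_rel_equiv.

Definition checkX0 : Type := quotient_topology {eq_quot galois_equiv}.

HB.instance Definition _ := Topological.on checkX0.

Definition to_checkX0 (u : checkX) : checkX0 := \pi_{eq_quot galois_equiv} u.

(* [kappa x] is isomorphic to an algebraic closure of ['F_p] iff it is one. *)
Definition dot_per : set dotX :=
  [set a | (exists2 p : nat, prime p &
              exists f : {rmorphism 'F_p -> kappa (dpt a)},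
                is_algebraic_closure f) /\
           finite_set [set z | z != 0 /\ dchar a z = 1]].

Definition dot_S1 : set dotX :=
  [set a | forall z, z != 0 -> `|dchar a z| = 1].

Definition checkX_per : set checkX := checkX_of dot_per.
Definition checkX_S1 : set checkX := checkX_of dot_S1.
Definition checkX0_per : set checkX0 := to_checkX0 @` checkX_per.
Definition checkX0_S1 : set checkX0 := to_checkX0 @` checkX_S1.

End ComplexPoints.

(* Main.v *)
From HB Require Import structures.
Require Import Defs.
From mathcomp Require Import all_boot all_order all_algebra.
From mathcomp Require Import cyclic separable closed_field cyclotomic finfield.
From mathcomp Require Import all_classical all_reals all_analysis.
From mathcomp Require Import complex zify ring.
Import Order.TTheory GRing.Theory Num.Theory.
Import numFieldNormedType.Exports.

Set Implicit Arguments.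
Unset Strict Implicit.
Unset Printing Implicit Defensive.

Local Open Scope ring_scope.

(* The values of a character of [kappa x] with values in the circle on finitely
   many functions [r_i] are approximated as follows.  Specialize [x] to a point
   [y] with [kappa y] an algebraic closure of a finite field, chosen so that the
   finitely many relevant differences of monomials in the [r_i] that do not
   vanish at [x] do not vanish at [y] either: this is the Nullstellensatz over
   the integers.  Let [om] be an injective character of the units of [kappa y];
   its powers have finite kernel.  Averaging the even powers of the modulus of
   [sum_i conj(c_i) om(r_i)^j] over a common period of the [om(r_i)] only the
   trivial relations between the [r_i] contribute, so that some [j] makes all
   the terms of this sum nearly equal: the tuple [(om^j(r_i))_i] is close to the
   prescribed tuple [(c_i)_i].  The reverse inclusions hold because the units of [kappa y] are roots of unity and the unitary
   characters form a closed set, stable under the Galois group. *)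

(** * Powers of roots of unity approximating points of a torus *)

(** Bernoulli's inequality [(1 + 1/e)^h >= 1 + h/e], with denominators cleared. *)
Lemma exp_succ_ge (e h : nat) : (e ^ h * (e + h) <= e * e.+1 ^ h)%N.
Proof.
elim: h => [|h IH]; first by rewrite !expn0; lia.
by rewrite !expnS; nia.
Qed.

Lemma exp_beats_poly (e n : nat) :
  exists M, (e ^ M * M.+1 ^ n < e.+1 ^ M)%N.
Proof.
case: n => [|n]; first by exists 1%N; rewrite !expn1 expn0 muln1.
case: e => [|e]; first by exists 1%N; rewrite !expn1 mul0n.
(* The square of Bernoulli's bound for [(1 + 1/E)^h] is quadratic in [h], whereas [M.+1 = 2hN + 1]
   is linear; this [h] is large enough for the former to win. *)
set E := e.+1; set N := n.+1; pose h := (2 * N.+1 * E ^ 2)%N.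
exists (h * 2 * N)%N; rewrite expnM [X in (_ < X)%N]expnM -expnMn ltn_exp2r //.
rewrite expnM [X in (_ < X)%N]expnM.
have H := exp_succ_ge E h.
have H2 : ((E ^ h * (E + h)) ^ 2 <= (E * E.+1 ^ h) ^ 2)%N by rewrite leq_sqr.
move: H2; rewrite !expnMn => H2.
have A0 : (0 < (E ^ h) ^ 2)%N by rewrite !expn_gt0.
have E0 : (0 < E ^ 2)%N by rewrite expn_gt0.
rewrite -(ltn_pmul2l E0); apply: leq_trans H2.
rewrite mulnCA ltn_pmul2l //.
have -> : ((E + h) ^ 2 = E ^ 2 + 2 * E * h + h * h)%N by ring.
rewrite {4}/h; nia.
Qed.

Section Approx.
Variables (C : numClosedFieldType).

Lemma unit_norm_conj (z : C) : `|z| = 1 -> z * z^* = 1.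
Proof. by move=> h; rewrite -normCK h expr1n. Qed.

Lemma mul_conj_eq1 (a b : C) : `|b| = 1 -> (a * b^* == 1) = (a == b).
Proof.
move/unit_norm_conj => U; apply/eqP/eqP => [h|->//].
by rewrite -[LHS]mulr1 -U mulrCA h mulr1.
Qed.

(** By the parallelogram law, [t i + t j] has modulus at most [2 - 1/(4k^2)], so the whole sum falls
    short of [n] by at least [1/(4k^2)]. Multiplying by [4k^2 n] lets powers of the bound be
    compared in the natural numbers later. *)
Lemma sum_norm_le_far (n k : nat) (t : 'I_n -> C) (i j : 'I_n) :
  (forall i, `|t i| = 1) -> (0 < k)%N -> k%:R^-1 <= `|t i - t j| ->
  `|\sum_l t l| * (4 * k ^ 2 * n)%:R <= n%:R * (4 * k ^ 2 * n).-1%:R.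
Proof.
move=> t1 k0 far.
have ij : j != i.
  by apply: contraTneq far => ->; rewrite subrr normr0 lt_geF // invr_gt0 ltr0n.
have n0 : (0 < n)%N by exact: leq_ltn_trans (leq0n _) (ltn_ord i).
have kR : (0 : C) < k%:R by rewrite ltr0n.
have nR : (0 : C) < n%:R by rewrite ltr0n.
have par : `|t i + t j| ^+ 2 + `|t i - t j| ^+ 2 = 4.
  rewrite !normCK !rmorphD !rmorphN /=.
  have := unit_norm_conj (t1 i); have := unit_norm_conj (t1 j) => h1 h2.
  transitivity (2 * (t i * (t i)^*) + 2 * (t j * (t j)^*)); first by ring.
  by rewrite h1 h2; ring.
have n2 : (2 <= n)%N.
  by have := ltn_ord i; have := ltn_ord j; move: ij; rewrite -val_eqE /=; lia.
have S : `|\sum_l t l| <= `|t i + t j| + (n - 2)%:R.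
  rewrite (bigD1 i) //= (bigD1 j) //= addrA.
  apply: le_trans (ler_normD _ _) _; rewrite lerD2l.
  apply: le_trans (ler_norm_sum _ _ _) _.
  rewrite (eq_bigr (fun _ => 1)) => [|l _]; last exact: t1.
  rewrite sumr_const ler_nat.
  have := cardC (pred2 i j); rewrite card_ord card2 eq_sym ij.
  rewrite (@eq_card _ [predC pred2 i j] (fun l => (l != i) && (l != j))).
    by move=> h; rewrite leq_subRL // h.
  by move=> l; rewrite !inE negb_or.
have S2 : `|t i + t j| ^+ 2 <= 4 - (k%:R^-1) ^+ 2.
  have : (k%:R^-1) ^+ 2 <= `|t i - t j| ^+ 2 by rewrite lerXn2r ?nnegrE ?invr_ge0 ?ler0n.
  by rewrite -par lerBrDr lerD2l.
have S3 : `|t i + t j| <= 2 - (4 * k%:R ^+ 2)^-1.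
  rewrite -(@ler_sqr _ _ _) ?nnegrE //; last first.
    rewrite subr_ge0 invf_ple ?posrE //; last by rewrite mulr_gt0 ?exprn_gt0.
    have : (1 : C) <= k%:R by rewrite ler1n.
    move=> h; have h2 : (1 : C) <= k%:R ^+ 2 by rewrite exprn_ege1.
    apply: (@le_trans _ _ 1); first by rewrite invf_le1 // ler1n.
    rewrite -[X in X <= _]mulr1; apply: ler_pM => //; rewrite ler1n //.
  apply: le_trans S2 _.
  have -> : (2 - (4 * k%:R ^+ 2)^-1) ^+ 2 = 4 - k%:R^-1 ^+ 2 + ((4 * k%:R ^+ 2)^-1 ^+ 2 : C).
    by field; rewrite gt_eqF.
  by rewrite lerDl exprn_ge0 // invr_ge0 mulr_ge0 // exprn_ge0 // ltW.
set d := (4 * k ^ 2 * n)%N.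
have d0 : (0 < d)%N by rewrite /d !muln_gt0 k0 n0.
have dR : (d%:R : C) != 0 by rewrite pnatr_eq0 -lt0n.
apply: le_trans (_ : (n%:R - (4 * k%:R ^+ 2)^-1) * d%:R <= _).
  rewrite ler_wpM2r ?ler0n //; apply: le_trans S _.
  apply: le_trans (lerD S3 (lexx _)) _.
  rewrite natrB // [leLHS](_ : _ = n%:R - (4 * k%:R ^+ 2)^-1) //; ring.
have -> : (d.-1)%:R = d%:R - 1 :> C by rewrite -subn1 natrB.
rewrite /d natrM natrM natrX [leLHS](_ : _ = n%:R * (4 * k%:R ^+ 2 * n%:R - 1)) //; field.
by rewrite gt_eqF.
Qed.

(** The period of exponents starts at 1, so that the exponent selected later is positive. *)
Lemma sum_unity_root (q : nat) (v : C) : v ^+ q = 1 ->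
  \sum_(j < q) v ^+ j.+1 = (if v == 1 then q%:R else 0).
Proof.
move=> vq; case: eqP => [->|/eqP v1].
  by under eq_bigr do rewrite expr1n; rewrite sumr_const card_ord.
under eq_bigr do rewrite exprS; rewrite -mulr_sumr.
have /eqP := subrX1 v q; rewrite vq subrr eq_sym mulf_eq0 subr_eq0 (negPf v1) /=.
by move/eqP->; rewrite mulr0.
Qed.

(* Words with the same letters, up to order, have the same product, and there
   are at most [M.+1 ^ n] letter counts, so some count is shared by many
   words. *)
Lemma many_equal_products (n M : nat) (u : 'I_n -> C) :
  ((n ^ M) ^ 2 <= (M.+1 ^ n) ^ 2 *
     #|[set w : {ffun 'I_M -> 'I_n} * {ffun 'I_M -> 'I_n} |
        (\prod_t u (w.1 t))%R == (\prod_t u (w.2 t))%R]|)%N.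
Proof.
pose W := {ffun 'I_M -> 'I_n}.
have cnt_lt (w : W) i : (#|[set t | w t == i]| < M.+1)%N.
  by rewrite ltnS; apply: leq_trans (max_card _) _; rewrite card_ord.
pose cnt (w : W) : {ffun 'I_n -> 'I_M.+1} := [ffun i => Ordinal (cnt_lt w i)].
have uE (w : W) : \prod_t u (w t) = \prod_i u i ^+ cnt w i.
  rewrite (partition_big w xpredT) //=; apply: eq_bigr => i _.
  rewrite (eq_bigr (fun=> u i)) => [|t /eqP-> //].
  by rewrite prodr_const ffunE /= cardsE.
have cN : #|{ffun 'I_n -> 'I_M.+1}| = (M.+1 ^ n)%N.
  by rewrite card_ffun !card_ord.
have [c0 hc] : exists c0, (n ^ M <= M.+1 ^ n * #|[set w | cnt w == c0]|)%N.
  have [|c0 hc0] := @bigop.eq_bigmax _ (fun c => #|[set w : W | cnt w == c]|).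
    by rewrite cN expn_gt0.
  exists c0; rewrite -hc0 -cN -sum_nat_const.
  rewrite -{1}(card_ord n) -{1}(card_ord M) -card_ffun -sum1_card.
  rewrite (partition_big cnt xpredT) //=; apply: leq_sum => c _.
  rewrite sum1_card; apply: leq_trans (bigop.leq_bigmax c).
  by rewrite cardsE.
set Z := [set w | cnt w == c0] in hc *.
have: (#|finset.setX Z Z| <= #|[set w : W * W |
    (\prod_t u (w.1 t))%R == (\prod_t u (w.2 t))%R]|)%N.
  apply/subset_leq_card/fintype.subsetP => -[w w']; rewrite !inE /= => /andP[/eqP h /eqP h'].
  by rewrite !uE h h'.
rewrite finset.cardsX => h; apply: leq_trans (leq_mul (leqnn _) h).
by rewrite mulnn -expnMn leq_sqr.
Qed.

(** If no [j] worked, every [S j] would have modulus at most [m(1 - 1/d)]; but the mean of the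
    [2M]-th powers over a period is the number of pairs of words with equal products, which is at
    least [m^(2M) / (M+1)^(2m)]. The length [M] depends on [n] and [k] only, so it can be fixed
    before the [u i] are known. *)
Lemma power_approx (n k : nat) : (0 < k)%N -> exists M : nat,
  forall (c u : 'I_n -> C) (q : nat), (0 < q)%N ->
    (forall i, `|c i| = 1) -> (forall i, u i ^+ q = 1) ->
    (forall w w' : {ffun 'I_M -> 'I_n},
       \prod_t u (w t) = \prod_t u (w' t) ->
       \prod_t c (w t) = \prod_t c (w' t)) ->
  exists j, forall i i',
    `|(c i)^* * u i ^+ j.+1 - (c i')^* * u i' ^+ j.+1| < k%:R^-1.
Proof.
move=> k0; case: n => [|n].
  by exists 0%N => c u q _ _ _ _; exists 0%N => -[].
set m := n.+1; set d := (4 * k ^ 2 * m)%N.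
have d0 : (0 < d)%N by rewrite /d !muln_gt0 k0.
have [M hM] := exp_beats_poly d.-1 m; rewrite prednK // in hM.
exists M => c u q q0 c1 uq rel.
have u1 i : `|u i| = 1.
  by apply/eqP; rewrite -(@pexpr_eq1 _ _ q) // -normrX uq normr1.
apply: contrapT => no.
have far j : exists i i',
    k%:R^-1 <= `|(c i)^* * u i ^+ j.+1 - (c i')^* * u i' ^+ j.+1|.
  apply: contrapT => nf; apply: no; exists j => i i'.
  rewrite real_ltNge ?realE ?invr_ge0 ?ler0n ?normr_ge0 //.
  by apply/negP => h; apply: nf; exists i, i'.
pose S j := \sum_l (c l)^* * u l ^+ j.+1.
have Sle j : `|S j| * d%:R <= m%:R * d.-1%:R.
  have [i [i' h]] := far j.
  apply: sum_norm_le_far h => // l.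
  by rewrite normrM norm_conjC c1 normrX u1 expr1n mul1r.
pose W := {ffun 'I_M -> 'I_m}.
have SM j : S j ^+ M = \sum_(w : W) (\prod_t c (w t))^* * (\prod_t u (w t)) ^+ j.+1.
  rewrite -[M in LHS]card_ord -prodr_const.
  rewrite bigA_distr_bigA /=; apply: eq_bigr => w _.
  by rewrite big_split /= rmorph_prod prodrXl.
have SS j : `|S j| ^+ (2 * M) = \sum_(w : W * W)
    ((\prod_t c (w.1 t))^* * \prod_t c (w.2 t)) *
    ((\prod_t u (w.1 t)) * (\prod_t u (w.2 t))^* ) ^+ j.+1.
  rewrite mulnC exprM -normrX normCK SM rmorph_sum mulr_suml.
  rewrite -(pair_bigA _ (fun w w' : W => ((\prod_t c (w t))^* * \prod_t c (w' t)) *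
    ((\prod_t u (w t)) * (\prod_t u (w' t))^* ) ^+ j.+1)) /=.
  apply: eq_bigr => w _; rewrite mulr_sumr; apply: eq_bigr => w' _.
  by rewrite rmorphM rmorphXn /= conjCK exprMn; ring.
set Z := [set w : W * W | \prod_t u (w.1 t) == \prod_t u (w.2 t)].
have nu (x : 'I_m -> C) (w : W) : (forall i, `|x i| = 1) -> `|\prod_t x (w t)| = 1.
  by move=> x1; rewrite normr_prod big1.
have tot : \sum_(j < q) `|S j| ^+ (2 * M) = q%:R * #|Z|%:R.
  under eq_bigr do rewrite SS.
  rewrite exchange_big /= -sum1_card natr_sum mulr_sumr [RHS]big_mkcond /=.
  apply: eq_bigr => -[w w'] _ /=; rewrite -mulr_sumr inE /= mulr1.
  have vE : (\prod_t u (w t) * (\prod_t u (w' t))^* == 1) =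
            (\prod_t u (w t) == \prod_t u (w' t)).
    exact/mul_conj_eq1/nu.
  rewrite sum_unity_root; last first.
    rewrite exprMn -rmorphXn -!prodrXl !big1 ?rmorph1 ?mulr1 //.
  (* For a surviving pair of words, the hypothesis [rel] makes the coefficient equal to 1. *)
  rewrite vE; case: eqP => [/rel->|_]; last by rewrite mulr0.
  by rewrite mulrC [_^* * _]mulrC (unit_norm_conj (nu c w' c1)) mulr1.
have := many_equal_products M u; rewrite -/Z => cZ.
have up : q%:R * #|Z|%:R * (d ^ (2 * M))%:R <= q%:R * ((m * d.-1) ^ (2 * M))%:R :> C.
  rewrite -tot mulr_suml -[q in leRHS]card_ord -sum1_card natr_sum mulr_suml.
  apply: ler_sum => j _; rewrite mul1r !natrX -exprMn lerXn2r ?nnegrE ?mulr_ge0 //.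
  by rewrite natrM.
rewrite -!natrM ler_nat -mulnA leq_pmul2l // in up.
move: up; rewrite [(2 * M)%N]mulnC !expnM expnMn.
move: hM; rewrite -ltn_sqr expnMn => hM; rewrite expnMn => up.
have m2 : (0 < (m ^ M) ^ 2)%N by rewrite !expn_gt0.
move: cZ hM up m2.
move: ((m ^ M) ^ 2)%N ((M.+1 ^ m) ^ 2)%N ((d.-1 ^ M) ^ 2)%N ((d ^ M) ^ 2)%N #|Z|.
move=> a b e D z h1 h2 h3 h4.
have : (a * D <= b * (a * e))%N.
  apply: leq_trans (leq_mul h1 (leqnn D)) _.
  by rewrite -mulnA leq_mul2l h3 orbT.
by rewrite mulnCA leq_pmul2l // mulnC leqNgt h2.
Qed.

End Approx.

(** * Injective characters of torsion multiplicative groups *)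

(** To [c] is added [m * t], where [t] is the part of [k] prime to [c]. A prime divisor of [k]
    divides exactly one of [c] and [t], and a prime divisor of [m] does not divide [c]. *)
Lemma coprime_lift (m k c : nat) : (0 < k)%N -> coprime c m ->
  exists c', (c' = c %[mod m])%N /\ coprime c' (m * k).
Proof.
(* The value [c = 0] forces [m = 1]; it is set apart because [\pi(0)] is empty. *)
move=> k0 cm; have [c0|c0] := posnP c.
  move: cm; rewrite c0 /coprime gcd0n => /eqP->.
  by exists 1%N; split; rewrite ?modn1 // /coprime gcd1n.
pose t := (k`_(\pi(c)^'))%N; exists (c + m * t)%N; split.
  by rewrite mulnC addnC modnMDl.
apply: contraT => ncop.
have g1 : (1 < gcdn (c + m * t) (m * k))%N.
  have [m0|m0] := posnP m.
    by move: cm ncop; rewrite m0 !mul0n addn0 => ->.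
  by rewrite ltn_neqAle eq_sym ncop gcdn_gt0 muln_gt0 m0 k0 orbT.
set q := pdiv (gcdn (c + m * t) (m * k)).
have qp : prime q by apply: pdiv_prime.
have := pdiv_dvd (gcdn (c + m * t) (m * k)); rewrite -/q dvdn_gcd => /andP[q1].
have cNm : (q %| c)%N -> (q %| m)%N -> false.
  move=> qc qm; have : (q %| gcdn c m)%N by rewrite dvdn_gcd qc qm.
  by rewrite (eqP cm) dvdn1 => /eqP q1'; rewrite q1' in qp.
have tE : (q %| k)%N -> (q %| t)%N = ~~ (q %| c)%N.
  move=> qk; have -> : (q %| t)%N = (q \in primes t).
    by rewrite mem_primes qp part_gt0.
  by rewrite primes_part mem_filter !inE !mem_primes qp k0 c0 qk /= andbT.
rewrite Euclid_dvdM // => /orP[qm|qk].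
  by apply: cNm (qm); move: q1; rewrite dvdn_addl // dvdn_mulr.
have [qc|qc] := boolP (q %| c)%N.
  move: q1; rewrite dvdn_addr // Euclid_dvdM // tE // qc orbF.
  exact: cNm.
by move: q1; rewrite dvdn_addl ?(negPf qc) // dvdn_mull // tE.
Qed.

Lemma closed_prim_root (F : closedFieldType) (n : nat) :
  (n%:R : F) != 0 -> exists z : F, n.-primitive_root z.
Proof.
move=> n0; have n_gt0 : (0 < n)%N by case: n n0; rewrite ?eqxx.
have [r] := closed_field_poly_normal ('X^n - 1 : {poly F}).
rewrite lead_coefDl ?size_polyXn ?size_polyN ?size_poly1 //.
rewrite lead_coefXn scale1r => rE.
have sz : size r = n.
  by have := size_prod_XsubC r id; rewrite -rE size_XnsubC // => -[].
have un : uniq r by rewrite -separable_prod_XsubC -rE separable_Xn_sub_1.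
have : has n.-primitive_root r.
  apply: has_prim_root => //; last by rewrite sz.
  apply/allP => z zr; rewrite unity_rootE -subr_eq0.
  have : root (\prod_(i <- r) ('X - i%:P)) z by rewrite root_prod_XsubC.
  by rewrite -rE rootE !hornerE.
by case/hasP => z _ hz; exists z.
Qed.

(** For a primitive [m * k]-th root [h], the given [g] is a power of [h ^+ k] with exponent prime to
    [m]. Lifting this exponent to one prime to [m * k] gives the power of [h] to take. *)
Lemma prim_root_lift (F : closedFieldType) (m k : nat) (g : F) :
  m.-primitive_root g -> ((m * k)%:R : F) != 0 ->
  exists2 g', (m * k).-primitive_root g' & g' ^+ k = g.
Proof.
move=> gm mk0; have [h hmk] := closed_prim_root mk0.
have m0 : (0 < m)%N by apply: prim_order_gt0 gm.
have k0 : (0 < k)%N by move: (prim_order_gt0 hmk); rewrite muln_gt0 m0.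
have hkm : m.-primitive_root (h ^+ k).
  have := dvdn_prim_root hmk (dvdn_mulr k (dvdnn m)).
  by rewrite mulKn.
have [c gE] := prim_rootP hkm (prim_expr_order gm).
have cm : coprime c m.
  by rewrite -(prim_root_exp_coprime _ hkm) -gE.
have [c' [cc' cop]] := coprime_lift k0 cm.
exists (h ^+ c'); first by rewrite prim_root_exp_coprime.
rewrite gE -exprM mulnC exprM; apply/eqP.
by rewrite (eq_prim_root_expr hkm) cc'.
Qed.

Lemma compatible_prim_roots (F : closedFieldType) (k : nat -> nat) :
  (forall n, ((k n)%:R : F) != 0) ->
  exists g : nat -> F, forall n,
    (\prod_(i < n) k i).-primitive_root (g n) /\ g n.+1 ^+ k n = g n.
Proof.
move=> k0; pose m n := (\prod_(i < n) k i)%N.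
have m0 n : ((m n)%:R : F) != 0.
  by rewrite natr_prod; apply/prodf_neq0 => i _.
pose T n := {x : F | (m n).-primitive_root x}.
have next n (x : T n) : {y : T n.+1 | val y ^+ k n = val x}.
  have h : ((m n * k n)%:R : F) != 0 by have := m0 n.+1; rewrite /m big_ord_recr.
  have [y yp yE] := cid2 (prim_root_lift (valP x) h).
  have yp' : (m n.+1).-primitive_root y by rewrite /m big_ord_recr.
  by exists (exist _ y yp').
have x0 : T 0%N.
  exists 1; rewrite /m big_ord0; apply/andP; split=> //.
  by apply/forallP => i; rewrite ord1 unity_rootE expr1n eqxx.
pose g := fix g n : T n := if n is n'.+1 then sval (next n' (g n')) else x0.
exists (fun n => val (g n)) => n; split; first exact: (valP (g n)).
exact: (svalP (next n (g n))).
Qed.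

Section Tower.
Variables (F : fieldType) (k : nat -> nat) (g : nat -> F).
Let m n := (\prod_(i < n) k i)%N.
Hypothesis gP : forall n, (m n).-primitive_root (g n) /\ g n.+1 ^+ k n = g n.

Lemma tower_expr n d : g (n + d) ^+ (\prod_(n <= i < n + d) k i) = g n.
Proof.
elim: d => [|d IH]; first by rewrite addn0 big_geq.
rewrite addnS big_nat_recr ?leq_addr //= mulnC exprM.
by have [_ ->] := gP (n + d).
Qed.
End Tower.

(* The powers of compatible systems of primitive roots of unity in [F] and [G]
   are matched. *)
Lemma torsion_embedding (F G : closedFieldType) (k : nat -> nat) :
  (forall n, ((k n)%:R : F) != 0) -> (forall n, ((k n)%:R : G) != 0) ->
  (forall z : F, z != 0 -> exists n, z ^+ (\prod_(i < n) k i) = 1) ->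
  exists w : F -> G, [/\ w 0 = 0, GRing.monoid_morphism w &
    forall z, w z = 1 -> z = 1].
Proof.
move=> kF kG tor.
have [g gP] := compatible_prim_roots kF.
have [h hP] := compatible_prim_roots kG.
have ex z : exists w, z != 0 -> exists n i, z = g n ^+ i /\ w = h n ^+ i.
  have [->|z0] := eqVneq z 0; first by exists 0.
  have [n zn] := tor z z0; have [i zE] := prim_rootP (gP n).1 zn.
  by exists (h n ^+ i) => _; exists n, i.
have [w0 w0P] := choice ex.
pose w z := if z == 0 then 0 else w0 z.
have up n d i : g n ^+ i = g (n + d)%N ^+ (\prod_(n <= l < n + d) k l * i) /\
                h n ^+ i = h (n + d)%N ^+ (\prod_(n <= l < n + d) k l * i).
  by rewrite !exprM !(tower_expr gP) !(tower_expr hP).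
have com z z' : z != 0 -> z' != 0 -> exists n i j,
    [/\ z = g n ^+ i, w z = h n ^+ i, z' = g n ^+ j & w z' = h n ^+ j].
  move=> z0 z'0; rewrite /w (negPf z0) (negPf z'0).
  have [n [i [-> ->]]] := w0P z z0; have [n' [j [-> ->]]] := w0P z' z'0.
  have [e1 e2] := up n n' i; have [e3 e4] := up n' n j.
  rewrite addnC in e3 e4.
  by exists (n + n')%N; do 2 eexists; split; [exact: e1|exact: e2|exact: e3|exact: e4].
(* [g n] and [h n] are primitive roots of the same order, so equality of powers is the same
   congruence of exponents on both sides. Hence [w] is independent of the chosen exponents and
   injective. *)
have gh n i j : (g n ^+ i == g n ^+ j) = (h n ^+ i == h n ^+ j).
  by rewrite (eq_prim_root_expr (gP n).1) (eq_prim_root_expr (hP n).1).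
have wE n i : w (g n ^+ i) = h n ^+ i.
  have g0 : g n ^+ i != 0.
    by rewrite expf_neq0 // (prim_root_eq0 (gP n).1) -lt0n (prim_order_gt0 (gP n).1).
  have [l [a [b [e1 e2 _ _]]]] := com _ _ g0 g0.
  have [f1 f2] := up n l i; have [f3 f4] := up l n a.
  rewrite addnC in f3 f4.
  rewrite e2 f2 f4; apply/eqP; rewrite -gh -f1 -f3; exact/eqP.
exists w; split.
- by rewrite /w eqxx.
- split; first by rewrite -(expr0 (g 0%N)) wE expr0.
  move=> a b; have [->|a0] := eqVneq a 0; first by rewrite mul0r /w eqxx mul0r.
  have [->|b0] := eqVneq b 0; first by rewrite mulr0 /w eqxx mulr0.
  have [n [i [j [e1 e2 e3 e4]]]] := com a b a0 b0.
  by rewrite e2 e4 e1 e3 -!exprD wE.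
move=> z; have [->|z0] := eqVneq z 0.
  by rewrite /w eqxx => /eqP; rewrite eq_sym oner_eq0.
have [n [i [_ [e1 e2 _ _]]]] := com z z z0 z0.
rewrite e2 e1 => /eqP h1; apply/eqP; have := gh n i 0%N; rewrite !expr0 => ->.
exact: h1.
Qed.

(** The axiom becomes a structure on the same field, so that the theory of closed fields applies
    after substitution. *)
Lemma closedFieldType_of (k : fieldType) : GRing.closed_field_axiom k ->
  exists F : closedFieldType, k = F :> fieldType.
Proof.
case: k => T c; set k := GRing.Field.Pack c => kcl.
pose kcc := Field_isAlgClosed.Build k kcl.
by exists (HB.pack_for closedFieldType T k kcc).
Qed.

Lemma injective_unit_char (R : realType) (k : fieldType) (p : nat) :
  GRing.closed_field_axiom k -> p \in [pchar k] ->
  (forall z : k, z != 0 -> exists2 d, (0 < d)%N & z ^+ d = 1) ->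
  exists w : unit_char R k, forall z, w z = 1 -> z = 1.
Proof.
move=> kcl pk tor.
have [F kE] := closedFieldType_of kcl; subst k.
have [pp p0] := andP pk.
(* Only orders prime to [p] occur in characteristic [p]. The tower therefore runs through the
   prime-to-[p] parts of the factorials, and each such order divides one of them. *)
pose K n := ((n.+1)`_p^')%N.
have K0 n : (0 < K n)%N by apply: part_gt0.
have KF n : ((K n)%:R : F) != 0.
  rewrite -(dvdn_pcharf pk) -p'natE ?(pcharf_prime pk) //.
  exact: part_pnat.
have KC n : ((K n)%:R : R[i]) != 0 by rewrite pnatr_eq0 -lt0n.
have KE n : (\prod_(i < n) K i = (n`!)`_p^')%N.
  elim: n => [|n IH]; first by rewrite big_ord0 fact0 partn1.
  by rewrite big_ord_recr /= IH factS mulnC partnM // fact_gt0.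
have tF (z : F) : z != 0 -> exists n, z ^+ (\prod_(i < n) K i) = 1.
  move=> z0; have [d d0 zd] := tor z z0; exists d; rewrite KE.
  have /dvdnP[c ->] : (d`_p^' %| (d`!)`_p^')%N.
    by apply: partn_dvd; [exact: fact_gt0|apply: dvdn_fact; rewrite d0 leqnn].
  rewrite mulnC exprM; suff -> : z ^+ (d`_p^')%N = 1 by rewrite expr1n.
  (* The [p]-part of the exponent is removed by injectivity of the Frobenius map. *)
  have {zd} := zd; rewrite -{1}(partnC p d0) mulnC exprM p_part; move: (z ^+ (d`_p^')%N) => y.
  elim: (logn p d) => [|n IH]; first by rewrite expn0 expr1.
  rewrite expnS mulnC exprM => h; apply: IH.
  by apply: (fmorph_inj (pFrobenius_aut pk)); rewrite rmorph1; exact: h.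
have [w [w0 wM winj]] := torsion_embedding KF KC tF.
by exists (@UnitChar R F w w0 wM).
Qed.

Local Open Scope classical_set_scope.
Local Open Scope ring_scope.

(** * The Nullstellensatz over the integers *)

Section LocallyIntegral.
Variables (k : fieldType) (D : comNzRingType) (rho : {rmorphism D -> k}).
Local Notation int := (integralOver rho).

Lemma integral_eqn (u : k) n (b : nat -> k) :
  (forall i, (i < n)%N -> int (b i)) ->
  u ^+ n + \sum_(i < n) b i * u ^+ i = 0 -> int u.
Proof.
move=> hb hu; pose p := 'X^n + \poly_(i < n) b i.
have sz : (size (\poly_(i < n) b i)%R < size ('X^n : {poly k}))%N.
  by rewrite size_polyXn ltnS size_poly.
apply: (@integral_root_monic _ _ rho u p).
- by rewrite monicE lead_coefDl // lead_coefXn.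
- by rewrite rootE hornerD hornerXn horner_poly hu.
apply/integral_poly => i; rewrite coefD coefXn coef_poly.
apply: integral_add; first exact: integral_nat.
by case: ifP => hi; [exact: hb|exact: mxpoly.integral0].
Qed.

Lemma integral_expr u n : int u -> int (u ^+ n).
Proof.
move=> hu; elim: n => [|n IH]; first exact: integral1.
by rewrite exprS; apply: integral_mul.
Qed.

(** Multiplying the equation of [s], of degree [n + 1], by [l ^+ n] turns it into a monic equation
    for [l * s]. *)
Lemma integral_lead_mul (p : {poly D}) s : map_poly rho p != 0 ->
  (map_poly rho p).[s] = 0 -> int (lead_coef (map_poly rho p) * s).
Proof.
set P := map_poly rho p => P0 Ps; set l := lead_coef P.
have P1 : (1 < size P)%N.
  by apply: (@root_size_gt1 _ s) => //; apply/eqP.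
pose n := (size P).-2; have szP : size P = n.+2 by rewrite /n; lia.
apply: (@integral_eqn _ n.+1 (fun i => P`_i * l ^+ (n - i))) => [i _|].
  apply: integral_mul; first by rewrite coef_map; exact: integral_id.
  by apply: integral_expr; rewrite /l lead_coefE coef_map; exact: integral_id.
transitivity (l ^+ n * P.[s]); last by rewrite Ps mulr0.
rewrite horner_coef szP [in RHS]big_ord_recr /= mulrDr addrC mulr_sumr; congr (_ + _).
  apply: eq_bigr => i _; have -> : l ^+ n = l ^+ (n - i) * l ^+ i.
    by rewrite -exprD subnK // -ltnS.
  by rewrite exprMn; ring.
by rewrite exprMn exprS /l lead_coefE szP /=; ring.
Qed.

(** The element [c] is the lowest nonzero coefficient of a monic equation of [v]; dividing by a
    power of [v] expresses [rho c / v] as a polynomial in [v]. *)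
Lemma integral_div_const (v : k) : v != 0 -> int v ->
  exists c, rho c != 0 /\ int (rho c / v).
Proof.
move=> v0 intv; have [q qm qv] := intv; set Q := map_poly rho q in qv.
have Q0 : Q != 0 by rewrite monic_neq0 // monic_map.
have ex : exists i, Q`_i != 0.
  by exists (size Q).-1; rewrite -lead_coefE lead_coef_eq0.
case: (ex_minnP ex) => m Qm mmin.
have ltQ : (m < size Q)%N by rewrite ltnNge; apply: contra Qm => h; rewrite nth_default.
exists q`_m; rewrite -coef_map -/Q; split=> //.
have Qv : Q`_m * v ^+ m + \sum_(m.+1 <= i < size Q) Q`_i * v ^+ i = 0.
  rewrite -(big_ltn (F := fun i => Q`_i * v ^+ i) ltQ).
  move: (rootP qv); rewrite horner_coef -(big_mkord xpredT (fun i => Q`_i * v ^+ i)).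
  rewrite (big_cat_nat (n := m)) //= ?(ltnW ltQ) // big1_seq ?add0r //.
  move=> i /andP[_]; rewrite mem_index_iota => /andP[_ im].
  have -> : Q`_i = 0; last by rewrite mul0r.
  by apply/eqP; apply: contraTT im => h; rewrite -leqNgt mmin.
have -> : Q`_m / v = - \sum_(j < size Q - m.+1) Q`_(m.+1 + j) * v ^+ j.
  apply/eqP; rewrite -addr_eq0; have vm : v ^+ m.+1 != 0 by rewrite expf_neq0.
  rewrite -(inj_eq (mulfI vm)) mulr0 -[X in _ == X]Qv.
  have -> : \sum_(m.+1 <= i < size Q) Q`_i * v ^+ i =
      \sum_(j < size Q - m.+1) Q`_(j + m.+1) * v ^+ (j + m.+1).
    by rewrite -{1}[m.+1]add0n big_addn big_mkord.
  rewrite mulrDr mulr_sumr; apply/eqP; congr (_ + _).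
    by rewrite exprS; field.
  by apply: eq_bigr => i _; rewrite [(i + _)%N]addnC exprD; ring.
apply: integral_opp; elim/big_rec: _ => [|i x _ hx]; first exact: mxpoly.integral0.
apply: integral_add => //; apply: integral_mul.
  by rewrite coef_map; exact: integral_id.
exact: integral_expr.
Qed.

(* [k] is integral over the localization of the image of [rho] at [d]. *)
Definition locally_integral (d : D) :=
  forall z : k, exists i, int (rho d ^+ i * z).

Lemma integral_clear (c : D) s (q : {poly D}) m : int (rho c * s) ->
  (size q <= m)%N -> int (rho c ^+ m * (map_poly rho q).[s]).
Proof.
move=> cs qm; rewrite (@horner_coef_wide _ m); last first.
  by apply: leq_trans qm; apply: size_poly.
rewrite mulr_sumr; elim/big_rec: _ => [|i x _ hx]; first exact: mxpoly.integral0.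
apply: integral_add => //.
have -> : rho c ^+ m * ((map_poly rho q)`_i * s ^+ i) =
   (rho c ^+ (m - i) * rho (q`_i)) * (rho c * s) ^+ i.
  have -> : rho c ^+ m = rho c ^+ (m - i) * rho c ^+ i.
    by rewrite -exprD subnK // ltnW.
  by rewrite coef_map exprMn; ring.
apply: integral_mul; last exact: integral_expr.
apply: integral_mul; last exact: integral_id.
by apply: integral_expr; exact: integral_id.
Qed.

End LocallyIntegral.

(** * Adjoining one element: the inductive step of Zariski's lemma *)

Section Adjoin.
Variables (k : fieldType) (D : comNzRingType) (rho : {rmorphism D -> k}) (s : k).

Definition adjoin_morph : {poly D} -> k :=
  horner_morph (fun a => mulrC s (rho a) : GRing.comm s (rho a)).
HB.instance Definition _ := GRing.RMorphism.on adjoin_morph.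

Lemma adjoin_morphE q : adjoin_morph q = (map_poly rho q).[s].
Proof. by []. Qed.

Lemma coef_adjoin (q : {poly {poly D}}) i :
  (map_poly adjoin_morph q)`_i = adjoin_morph q`_i.
Proof. exact: coef_map. Qed.

(** If [s] is algebraic over the image of [rho], it suffices to invert two constants: a leading
    coefficient [c1], for which [c1 * s] is integral, and a [c0] for which the quotient of [c0] by
    the value of [e] at [s] is integral. *)
Lemma adjoin_locally_integral (e : {poly D}) :
  adjoin_morph e != 0 -> locally_integral adjoin_morph e ->
  exists d, rho d != 0 /\ locally_integral rho d.
Proof.
move=> e0 loc.
have [[p [p0 ps]]|tr] :=
    pselect (exists p, map_poly rho p != 0 /\ adjoin_morph p = 0).
  have sint := integral_lead_mul p0 ps.
  set c1 := p`_(size (map_poly rho p)).-1.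
  have c1E : lead_coef (map_poly rho p) = rho c1 by rewrite lead_coefE coef_map.
  rewrite c1E in sint; have c10 : rho c1 != 0 by rewrite -c1E lead_coef_eq0.
  set v := adjoin_morph e in e0.
  set m := size e.
  have vint : integralOver rho (rho c1 ^+ m * v).
    by rewrite /v adjoin_morphE; exact: integral_clear.
  have [|c0 [c00 c0int]] := integral_div_const _ vint.
    by rewrite mulf_neq0 // expf_neq0.
  have {}c0int : integralOver rho (rho c0 / v).
    have -> : rho c0 / v = rho (c1 ^+ m) * (rho c0 / (rho c1 ^+ m * v)).
      by rewrite rmorphXn; field; rewrite e0 expf_neq0.
    by apply: integral_mul => //; exact: integral_id.
  exists (c0 * c1); split; first by rewrite rmorphM mulf_neq0.
  move=> z; have [i [q qm]] := loc z; rewrite -/v; set y := v ^+ i * z => qy.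
  set n := (size q).-1.
  (* The lower coefficients in the equation of [y] are polynomials in [s] of size at most [M], so
     the factor [c1 ^+ M] makes each of them integral. *)
  pose M := (\max_(j < n) size (q`_j)%R)%N.
  have yint : integralOver rho (rho c1 ^+ M * y).
    apply: (@integral_eqn _ _ _ _ n (fun j => (rho c1 ^+ M * (map_poly rho q`_j).[s]) *
              rho c1 ^+ (M * (n - j.+1)))) => [j jn|].
      apply: integral_mul; last by apply: integral_expr; exact: integral_id.
      apply: integral_clear => //.
      exact: (@bigop.leq_bigmax _ (fun j : 'I_n => size (q`_j)%R) (Ordinal jn)).
    transitivity (rho c1 ^+ (M * n) * (map_poly adjoin_morph q).[y]); last first.
      by rewrite (rootP qy) mulr0.
    rewrite (@horner_coef_wide _ n.+1); last first.
      by rewrite /n; apply: leq_trans (leqSpred _); apply: size_poly.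
    rewrite big_ord_recr /= [_`_n]coef_adjoin -lead_coefE (monicP qm) rmorph1 mul1r.
    rewrite mulrDr addrC mulr_sumr; congr (_ + _); last by rewrite exprMn exprM.
    apply: eq_bigr => j _; rewrite coef_adjoin adjoin_morphE exprMn -exprM.
    have -> : (M * n = M + M * (n - j.+1) + M * j)%N.
      transitivity (M * (1 + (n - j.+1) + j))%N; last by rewrite !mulnDr muln1.
      by congr (_ * _)%N; have := ltn_ord j; lia.
    by rewrite !exprD; ring.
  exists (i + M)%N.
  have -> : rho (c0 * c1) ^+ (i + M) * z =
     (rho c0 / v) ^+ i * rho (c0 ^+ M * c1 ^+ i) * (rho c1 ^+ M * y).
    rewrite !rmorphM !rmorphXn /y exprMn !exprD exprMn exprVn; field.
    by rewrite expf_neq0.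
  apply: integral_mul => //; apply: integral_mul; last exact: integral_id.
  exact: integral_expr.
have {}tr p : adjoin_morph p = 0 -> map_poly rho p = 0.
  by move=> h; apply/eqP; apply: contrapT => /negP p0; apply: tr; exists p.
(* If [s] is transcendental over the image of [rho], then [1 + e s] is coprime
   to [e], hence not invertible in the localization at [e]. *)
exfalso; set E := map_poly rho e.
have E0 : E != 0 by apply: contraNneq e0 => h; rewrite adjoin_morphE -/E h horner0.
pose w := 1 + e * 'X; set W := map_poly rho w.
have WE : W = 1 + E * 'X by rewrite /W /w rmorphD rmorphM rmorph1 /= map_polyX.
have szW : (1 < size W)%N.
  rewrite WE addrC size_polyDl ?size_mulX ?size_poly1 // ltnS lt0n ?size_poly_eq0 //.
have sw0 : adjoin_morph w != 0.
  apply/eqP => /tr h; move: szW; rewrite /W h size_poly0 //.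
have [i [q qm]] := loc (adjoin_morph w)^-1.
set n := (size q).-1; set y := _ * _ => qy.
(* The value of [T] at [s] is the equation of [y] multiplied by the [n]-th power of the value of
   [w]. Modulo [w] only the last term, [e ^+ (i * n)], remains. *)
pose T := \sum_(j < n.+1) q`_j * e ^+ (i * j) * w ^+ (n - j).
have T0 : adjoin_morph T = 0.
  transitivity (adjoin_morph w ^+ n * (map_poly adjoin_morph q).[y]); last first.
    by rewrite (rootP qy) mulr0.
  rewrite (@horner_coef_wide _ n.+1); last first.
    by rewrite /n; apply: leq_trans (leqSpred _); apply: size_poly.
  rewrite rmorph_sum mulr_sumr /=; apply: eq_bigr => j _.
  rewrite !rmorphM !rmorphXn coef_adjoin /y exprMn exprVn exprM /=.
  have jn : (j <= n)%N by rewrite -ltnS.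
  have -> : adjoin_morph w ^+ n = adjoin_morph w ^+ (n - j) * adjoin_morph w ^+ j.
    by rewrite -exprD subnK.
  by field; rewrite expf_neq0.
move/tr: T0; rewrite rmorph_sum big_ord_recr /= subnn expr0 mulr1.
rewrite -lead_coefE (monicP qm) mul1r rmorphXn /= -/E => T0.
have dvd : W %| E ^+ (i * n).
  move/eqP: T0; rewrite addrC addr_eq0 => /eqP->; rewrite dvdpNr.
  elim/big_ind: _ => [|a b ha hb|j _]; first exact: dvdp0.
    by rewrite dvdp_addl.
  rewrite rmorphM rmorphXn /= -/W; apply: dvdp_mull.
  by rewrite -(subnSK (ltn_ord j)) exprS dvdp_mulr.
have cop : coprimep W (E ^+ (i * n)).
  apply: coprimep_expr; apply/Bezout_coprimepP; exists (1, - 'X) => /=.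
  by rewrite WE (_ : _ + _ = 1) ?eqpxx //; ring.
have /coprimepP := cop.
move=> /(_ W (dvdpp _) dvd); rewrite -size_poly_eq1 => /eqP h.
by rewrite h in szW.
Qed.

End Adjoin.

Section IntegralOverSubring.
Variable (k : fieldType).

Lemma integral_over_range (D : comNzRingType) (rho : {rmorphism D -> k}) (z : k) :
  integral_over (range rho) z -> integralOver rho z.
Proof.
move=> [p [pm pc pz]].
apply: (integral_root_monic pm pz); apply/integral_poly => i.
by have [c _ <-] := pc i; exact: integral_id.
Qed.

Lemma sub_integral_over (S T : set k) z :
  S `<=` T -> integral_over S z -> integral_over T z.
Proof. by move=> ST [p [pm pc pz]]; exists p; split=> // i; apply: ST. Qed.

(** One polynomial variable is added per generator, so that [adjoin_locally_integral] can be
    iterated. *)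
Fixpoint adjoin (s : seq k) :
    forall (D : comNzRingType), {rmorphism D -> k} -> set k :=
  match s with
  | [::] => fun D rho => range rho
  | a :: s' => fun D rho => adjoin s' (adjoin_morph rho a)
  end.

Lemma adjoin_subring s (D : comNzRingType) (rho : {rmorphism D -> k}) :
  [/\ adjoin s rho 1, forall a b, adjoin s rho a -> adjoin s rho b -> adjoin s rho (a - b)
   & forall a b, adjoin s rho a -> adjoin s rho b -> adjoin s rho (a * b)].
Proof.
elim: s D rho => [|a s IH] D rho; last exact: IH.
split; first by exists 1; rewrite ?rmorph1.
  by move=> _ _ [x _ <-] [y _ <-]; exists (x - y); rewrite ?rmorphB.
by move=> _ _ [x _ <-] [y _ <-]; exists (x * y); rewrite ?rmorphM.
Qed.

Lemma adjoin_base s (D : comNzRingType) (rho : {rmorphism D -> k}) :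
  range rho `<=` adjoin s rho.
Proof.
elim: s D rho => [|a s IH] D rho //= _ [x _ <-]; apply: IH.
by exists x%:P => //; exact: horner_morphC.
Qed.

Lemma adjoin_mem s (D : comNzRingType) (rho : {rmorphism D -> k}) a :
  a \in s -> adjoin s rho a.
Proof.
elim: s D rho => [|b s IH] D rho //=; rewrite inE => /predU1P[->|as_]; last exact: IH.
by apply: adjoin_base; exists 'X => //; exact: horner_morphX.
Qed.

Lemma adjoin_zariski s (D : comNzRingType) (rho : {rmorphism D -> k}) e :
  adjoin s rho e -> e != 0 ->
  (forall z, exists i, integral_over (adjoin s rho) (e ^+ i * z)) ->
  exists d, rho d != 0 /\ locally_integral rho d.
Proof.
elim: s D rho => [|a s IH] D rho /=.
  move=> [d _ <-] d0 h; exists d; split=> // z.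
  by have [i hi] := h z; exists i; exact: integral_over_range.
move=> ee e0 /(IH _ _ ee e0)[d [d0 dl]].
exact: adjoin_locally_integral d0 dl.
Qed.

(** In characteristic zero, the inverse of a prime [p > |d|] would be integral over the integers
    with [d] inverted. Clearing denominators in its equation shows that [p] divides a power of [d],
    which is absurd. *)
Lemma locally_integral_pchar (d : int) : (d%:~R : k) != 0 ->
  locally_integral (intr : {rmorphism int -> k}) d -> exists p, p \in [pchar k].
Proof.
move=> d0 dl; apply: contrapT => no.
have k0 : [pchar k] =i pred0.
  by move=> p; apply/negP => h; apply: no; exists p.
have inj (n : int) : (n%:~R == 0 :> k) = (n == 0).
  apply/idP/eqP => [|->]; last by rewrite mulr0z.
  case: n => n; rewrite ?NegzE ?mulrNz ?oppr_eq0 -?pmulrn => h.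
    by have /pcharf0P/(_ n) := k0; rewrite h => /esym/eqP->.
  by have /pcharf0P/(_ n.+1) := k0; rewrite h.
have [p dp pp] := prime_above `|d|%N.
have p0 : (p%:~R : k) != 0 by rewrite inj -lt0n prime_gt0.
have [i [q qm qu]] := dl (p%:~R)^-1; move: qu; set u := _ * _ => qu.
set n := (size q).-1.
pose T : int := \sum_(j < n.+1) q`_j * d ^+ (i * j) * (p%:Z) ^+ (n - j).
have T0 : T = 0.
  apply/eqP; rewrite -inj; apply/eqP.
  transitivity ((p%:~R : k) ^+ n * (map_poly intr q).[u]); last first.
    by rewrite (rootP qu) mulr0.
  rewrite (@horner_coef_wide _ n.+1); last first.
    by rewrite /n; apply: leq_trans (leqSpred _); apply: size_poly.
  rewrite rmorph_sum mulr_sumr /=; apply: eq_bigr => j _.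
  rewrite !rmorphM !rmorphXn coef_map /u exprMn exprVn exprM /=.
  have -> : (p%:~R : k) ^+ n = p%:~R ^+ (n - j) * p%:~R ^+ j.
    by rewrite -exprD subnK // -ltnS.
  by field; rewrite expf_neq0.
have : (p%:Z %| d ^+ (i * n))%Z.
  move: T0; rewrite /T big_ord_recr /= subnn expr0 mulr1 -lead_coefE (monicP qm) mul1r.
  move/eqP; rewrite addrC addr_eq0 => /eqP ->; rewrite rpredN.
  elim/big_ind: _ => [|a b ha hb|j _]; first exact: dvdz0.
    exact: rpredD.
  by rewrite -(subnSK (ltn_ord j)) exprS dvdz_mull // dvdz_mulr.
rewrite dvdzE abszX Euclid_dvdX // => /andP[pd _].
have d0' : (0 < `|d|)%N by rewrite absz_gt0 -inj.
by have := dvdn_leq d0' pd; rewrite leqNgt dp.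
Qed.

End IntegralOverSubring.

(** * Fields algebraic over a prime field *)

Section AlgebraicOverPrimeField.
Variables (k : fieldType) (p : nat) (pk : p \in [pchar k]).

Let in_alg_k : {rmorphism 'F_p -> pPrimeCharType pk} := GRing.in_alg (pPrimeCharType pk).
Definition prime_field_morph : {rmorphism 'F_p -> k} := in_alg_k.

Lemma locally_integral_prime_field (d : int) : (d%:~R : k) != 0 ->
  locally_integral (intr : {rmorphism int -> k}) d -> integralRange prime_field_morph.
Proof.
move=> d0 dl z; have [i hz] := dl z.
have intI (x : k) : integralOver (intr : int -> k) x -> integralOver prime_field_morph x.
  move=> [q qm qx]; exists (map_poly intr q); first by rewrite monic_map.
  rewrite -map_poly_comp; rewrite (eq_map_poly (g := intr)) // => y.
  exact: rmorph_int.
have -> : z = ((d%:~R : k) ^+ i * z) / (d%:~R ^+ i).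
  by field; rewrite expf_neq0.
apply: integral_div; first exact: intI.
apply: intI; apply: integral_expr; exact: integral_id.
Qed.

(** There are finitely many remainders modulo a monic polynomial over a finite field, so two powers
    of [z] coincide. *)
Lemma prime_field_torsion (f : {rmorphism 'F_p -> k}) (z : k) : z != 0 ->
  integralOver f z -> exists2 d, (0 < d)%N & z ^+ d = 1.
Proof.
move=> z0 [q qm qz].
pose n := size q.
pose F (j : 'I_(#|{ffun 'I_n -> 'F_p}|.+1)) : {ffun 'I_n -> 'F_p} :=
  [ffun i => ('X^j %% q)`_(nat_of_ord i)].
have /injectivePn[i [j ij Fij]] : ~~ injectiveb F.
  by apply/injectiveP => /leq_card; rewrite card_ord ltnn.
have E : 'X^i %% q = 'X^j %% q.
  apply/polyP => l; have [ln|ln] := ltnP l n.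
    by have /ffunP/(_ (Ordinal ln)) := Fij; rewrite !ffunE.
  by rewrite !nth_default //; apply: leq_trans ln; rewrite ltnW // ltn_modp monic_neq0.
have zE m : z ^+ m = (map_poly f ('X^m %% q)).[z].
  transitivity (map_poly f 'X^m).[z]; first by rewrite map_polyXn hornerXn.
  rewrite {1}(divp_eq 'X^m q) rmorphD rmorphM hornerD hornerM.
  by rewrite (rootP qz) mulr0 add0r.
have zij : z ^+ i = z ^+ j by rewrite zE E -zE.
wlog ltij : i j ij zij {Fij E} / (i < j)%N.
  move=> W; have := ij; rewrite -val_eqE neq_ltn => /orP[h|h]; first exact: (W i j).
  by apply: (W j i) => //; rewrite eq_sym.
exists (j - i)%N; first by rewrite subn_gt0.
apply: (mulIf (expf_neq0 i z0)); rewrite mul1r -exprD subnK; last exact: ltnW.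
by [].
Qed.

End AlgebraicOverPrimeField.

Lemma integralOver_range (k : fieldType) (D : comNzRingType)
    (rho : {rmorphism D -> k}) (z : k) :
  integralOver rho z -> integral_over (range rho) z.
Proof.
move=> [p pm pz]; exists (map_poly rho p); split=> //; first by rewrite monic_map.
by move=> i; rewrite coef_map; exists p`_i.
Qed.

(* MathComp's theory of integral elements requires nontrivial rings, whereas
   rings of sections are only [comPzRingType]. *)
Lemma nontrivial_source (A : comPzRingType) (K : fieldType)
    (f : {rmorphism A -> K}) :
  exists (D : comNzRingType) (rho : {rmorphism D -> K}), range rho = range f.
Proof.
case: A f => T c; set A := GRing.ComPzRing.Pack c => f.
have h : (1 : A) != 0.
  by apply/eqP => /(congr1 f); rewrite rmorph1 rmorph0 => /eqP; rewrite oner_eq0.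
pose nz := GRing.PzSemiRing_isNonZero.Build A h.
pose D : comNzRingType := HB.pack_for comNzRingType T A nz.
by exists D, (f : {rmorphism D -> K}).
Qed.

(** The ideal [n] is maximal among those that contain [q] and no power of [f]. The last conclusion
    says that the quotient by [n] becomes a field once [f] is inverted. *)
Lemma exists_maximal_avoiding (B : comPzRingType) (q : set B) (f : B) :
  is_ideal q -> (forall i, ~ q (f ^+ i)) ->
  exists n : set B, [/\ is_prime_ideal n, q `<=` n, forall i, ~ n (f ^+ i) &
    forall b, ~ n b -> exists i c m, n m /\ f ^+ i = m + c * b].
Proof.
move=> qI qf.
pose P (A : set B) := A = set0 \/ [/\ is_ideal A, q `<=` A & forall i, ~ A (f ^+ i)].
have [|n [[n0|[nI qn nf]] nmax]] := @Zorn_bigcup B P.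
- move=> F FP Ftot.
  have [[A0 [FA0 A00]]|no] := pselect (exists A, F A /\ A <> set0); last first.
    left; apply/seteqP; split=> // b [A FA Ab].
    by apply: no; exists A; split=> // A0; rewrite A0 in Ab.
  have FI A b : F A -> A b -> [/\ is_ideal A, q `<=` A & forall i, ~ A (f ^+ i)].
    by move=> /FP[->|].
  have [A0I qA0 _] : [/\ is_ideal A0, q `<=` A0 & forall i, ~ A0 (f ^+ i)].
    by have [/A00|] := FP _ FA0.
  right; split.
  + split.
    * by exists A0 => //; case: A0I.
    * move=> a b [A FA Aa] [A' FA' A'b].
      have [AA'|A'A] := Ftot _ _ FA FA'.
        have [[_ h _] _ _] := FI _ _ FA' A'b.
        by exists A' => //; apply: h => //; exact: AA'.
      have [[_ h _] _ _] := FI _ _ FA Aa.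
      by exists A => //; apply: h => //; exact: A'A.
    * move=> a b [A FA Ab]; have [[_ _ h] _ _] := FI _ _ FA Ab.
      by exists A => //; exact: h.
  + by move=> b qb; exists A0 => //; exact: qA0.
  + by move=> i [A FA Af]; have [_ _ /(_ i)] := FI _ _ FA Af.
- exfalso; apply: (nmax q); last by right; split.
  rewrite n0 properEneq; split => //.
  by apply/eqP => h; have [q0 _ _] := qI; move: q0; rewrite -h => -[].
have [nO nD nM] := nI.
have ext b : ~ n b -> exists i c m, n m /\ f ^+ i = m + c * b.
  move=> nb; apply: contrapT => no.
  pose J : set B := [set x | exists c m, n m /\ x = m + c * b].
  apply: (nmax J).
    split; first by move=> x nx; exists 0, x; rewrite mul0r addr0.
    move=> /(_ b); apply: contra_not nb => h; apply: h.
    by exists 1, 0; rewrite mul1r add0r.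
  right; split.
  - split.
    + by exists 0, 0; rewrite mul0r addr0.
    + move=> _ _ [c [m [nm ->]]] [c' [m' [nm' ->]]].
      by exists (c + c'), (m + m'); split; [exact: nD|rewrite mulrDl addrACA].
    + move=> a _ [c [m [nm ->]]].
      by exists (a * c), (a * m); split; [exact: nM|rewrite mulrDr mulrA].
  - by move=> x /qn nx; exists 0, x; rewrite mul0r addr0.
  - by move=> i [c [m [nm fE]]]; apply: no; exists i, c, m.
exists n; split=> //; split=> //; first by have := nf 0%N; rewrite expr0.
move=> a b nab; apply: contrapT => /not_orP[na nb].
have [i [c [m [nm fi]]]] := ext a na; have [j [d [m' [nm' fj]]]] := ext b nb.
apply: (nf (i + j)%N); rewrite exprD fi fj mulrDl; apply: (nD).
  by rewrite mulrC; exact: nM.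
rewrite mulrDr; apply: (nD); first exact: nM.
by rewrite mulrACA; exact: nM.
Qed.

(** * Schemes and normalizations *)

Section Schemes.

Lemma nonvanishing_open (X : lrspace) (U : opens X) (s : sec U) :
  open (nonvanishing s).
Proof.
rewrite openE => x [Ux sx].
have [V [VU [Vx [t st]]]] := ev_unit sx.
apply: filterS (open_nbhs_nbhs (conj (oset_open V) Vx)) => y Vy.
exists (VU y Vy); rewrite -ev_res; apply/eqP => s0.
have /eqP := congr1 (ev Vy) st.
by rewrite rmorphM s0 mul0r rmorph1 eq_sym oner_eq0.
Qed.

(** A section near [x] with value [z] is restricted to a principal open set, where sections are
    fractions of sections over [U]. *)
Lemma ev_fraction (X : lrspace) (U : opens X) (x : X) (Ux : U x) (z : kappa x) :
  is_affine U -> exists a b : sec U, ev Ux b != 0 /\ z = ev Ux a / ev Ux b.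
Proof.
move=> [_ _ basis loc]; have [V [Vx [t tz]]] := ev_surj z.
pose UV := Opens (openI (oset_open U) (oset_open V)).
have [|//|s [[Us sx] sUV]] := basis UV x; first by move=> y [].
pose D := Opens (nonvanishing_open s).
have DU : D `<=` U by move=> y /sUV[].
have DV : D `<=` V by move=> y /sUV[].
have [/(_ (res DV t))[a [n an]] _] := loc s D DU erefl.
have Dx : D x by exists Us.
exists a, (s ^+ n); rewrite (Prop_irrelevance Us Ux) in sx.
split; first by rewrite rmorphXn expf_neq0.
have := congr1 (ev Dx) an; rewrite rmorphM rmorphXn !ev_res.
rewrite (Prop_irrelevance (DU x Dx) Ux) (Prop_irrelevance (DV x Dx) Vx) tz => ->.
by rewrite rmorphXn; field; rewrite expf_neq0.
Qed.

(** Uniqueness of gluing along the empty cover. *)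
Lemma sec_set0 (X : lrspace) (D : opens X) : oset D = set0 ->
  forall s t : sec D, s = t.
Proof.
move=> D0 s t.
have VU (i : void) : (fun i : void => match i with end : opens X) i `<=` D by case: i.
have [||u [_ uu]] := @sec_glue X D void (fun i => match i with end) VU _
  (fun i => match i with end).
- by rewrite D0.
- by case.
by rewrite -(uu s) ?(uu t) //; case.
Qed.

Lemma generic_mem (X : topologicalType) (eta : X) (U : set X) (x : X) :
  closure [set eta] = setT -> open U -> U x -> U eta.
Proof.
move=> etaT oU Ux; have : closure [set eta] x by rewrite etaT.
by move=> /(_ U (open_nbhs_nbhs (conj oU Ux)))[_ [-> ]].
Qed.

(** The open set [nonvanishing s] misses the generic point, hence is empty. On it 1 restricts to 0,
    so the localization property makes a power of [s] vanish. *)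
Lemma ev_generic_eq0 (X : scheme) (eta : X) (U : opens X) (Ueta : U eta)
    (s : sec U) :
  is_integral X -> is_generic_point eta -> is_affine U -> ev Ueta s = 0 -> s = 0.
Proof.
move=> [_ Xint] etaG [_ _ _ loc] s0.
have D0 : nonvanishing s = set0.
  apply/seteqP; split=> // x sx.
  have [U' ] := generic_mem etaG (nonvanishing_open s) sx.
  by rewrite (Prop_irrelevance U' Ueta) s0 eqxx.
pose D := Opens (nonvanishing_open s).
have DU : D `<=` U by rewrite /D /= D0.
have [_ /(_ 1)] := loc s D DU erefl.
have [U1 UM] := Xint U (ex_intro _ eta Ueta).
case; first by apply: sec_set0.
move=> n; rewrite mulr1; elim: n => [|n IH].
  by rewrite expr0 => h; rewrite h eqxx in U1.
by rewrite exprS => /UM[].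
Qed.

End Schemes.

(** * Functions and residue fields of the normalization over an affine piece *)

Section Normalization.
Context {X0 : scheme} {eta0 : X0} {K : fieldType}.
Context {iota : {rmorphism kappa eta0 -> K}}.
Variable X : normalization iota.
Local Notation pi := (nrm_pi X).
Local Notation W := (Defs.preim (mor_cont (nrm_pi X))).
Local Notation eta := (nrm_eta X).

Section AffinePiece.
Variables (U : opens X0) (Uaff : is_affine U) (U0 : U eta0) (U1 : U (pi eta)).

Definition sec_in_K : {rmorphism sec (W U) -> K} :=
  nrm_theta X \o @ev X (W U) eta U1.

Lemma sec_in_K_inj : injective sec_in_K.
Proof.
move=> s t /= /(bij_inj (nrm_theta_bij X)) st.
apply/eqP; rewrite -subr_eq0; apply/eqP.
apply: (@ev_generic_eq0 X eta (W U) U1 _ (nrm_integral X) (nrm_generic X)).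
  exact: nrm_affine.
by rewrite rmorphB st subrr.
Qed.

Lemma sec_in_K_mor_sec (a : sec U) : sec_in_K (mor_sec pi U a) = iota (ev U0 a).
Proof. exact: nrm_over. Qed.

Lemma sec_integral (s : sec (W U)) : exists n (a : nat -> sec U),
  s ^+ n + \sum_(i < n) mor_sec pi U (a i) * s ^+ i = 0.
Proof.
have [_ h] := nrm_closure X U0 (sec_in_K s) Uaff.
have [p [pm pc ps]] := h (ex_intro _ U1 (ex_intro _ s erefl)).
have /choice[a aE] : forall i, exists c : sec U, iota (ev U0 c) = p`_i.
  by move=> i; have [c _ cE] := pc i; exists c.
exists (size p).-1, a; apply: sec_in_K_inj.
rewrite rmorph0 rmorphD rmorphXn rmorph_sum -[RHS](rootP ps).
rewrite (@horner_coef_wide _ (size p).-1.+1) ?leqSpred // big_ord_recr /=.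
rewrite -lead_coefE (monicP pm) mul1r addrC; congr (_ + _).
by apply: eq_bigr => i _; rewrite -aE -sec_in_K_mor_sec /= !rmorphM !rmorphXn.
Qed.

(** An integral closure is integrally closed. The equation has the shape that
    [GRing.closed_field_axiom] produces. *)
Lemma integral_sec (z : K) n (c : nat -> sec (W U)) :
  z ^+ n = \sum_(i < n) sec_in_K (c i) * z ^+ i -> exists w, sec_in_K w = z.
Proof.
move=> zE; have [h _] := nrm_closure X U0 z Uaff.
have [D [rho rhoE]] := nontrivial_source (iota \o @ev X0 U eta0 U0).
have [|U1' [w wE]] := h; last first.
  by exists w; rewrite -wE /sec_in_K /= (Prop_irrelevance U1 U1').
have -> : [set iota (ev U0 s) | s in [set: sec U]] = range rho by rewrite rhoE.
apply: integralOver_range.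
apply: (@integral_eqn _ _ rho z n (fun i => - sec_in_K (c i))) => [i _|].
  apply: integral_opp; apply: integral_over_range; rewrite rhoE.
  have [_ h'] := nrm_closure X U0 (sec_in_K (c i)) Uaff.
  exact: h' (ex_intro _ U1 (ex_intro _ (c i) erefl)).
under eq_bigr do rewrite mulNr; by rewrite sumrN zE subrr.
Qed.

(** Write the coefficients as [c i / b] with a common denominator. For a root [w / b] the equation
    becomes monic in [w] with sections as coefficients; it is solved in [K], and the solution is a
    section by integrality. *)
Lemma kappa_closed (Kcl : GRing.closed_field_axiom K) (y : X) (Uy : U (pi y)) :
  GRing.closed_field_axiom (kappa y).
Proof.
move=> n P n0; pose E := @ev X (W U) y Uy.
have Waff := nrm_affine X Uaff.
have /choice[ab abP] : forall i, exists ab : sec (W U) * sec (W U),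
    E ab.2 != 0 /\ P i = E ab.1 / E ab.2.
  move=> i; have [a [b h]] := @ev_fraction X (W U) y Uy (P i) Waff.
  by exists (a, b).
pose b := \prod_(i < n) (ab i).2.
have b0 : E b != 0.
  by rewrite rmorph_prod; apply/prodf_neq0 => i _; have [] := abP i.
have /choice[c cE] : forall i, exists c : sec (W U), (i < n)%N -> P i = E c / E b.
  move=> i; have [ltin|] := boolP (i < n)%N; last by exists 0.
  exists ((ab i).1 * \prod_(j < n | j != Ordinal ltin) (ab j).2) => _.
  have [h0 ->] := abP i; set c := \prod_(j < n | _) _.
  have bE : b = (ab i).2 * c by rewrite /b (bigD1 (Ordinal ltin)).
  move: b0; rewrite bE !rmorphM mulf_eq0 negb_or => /andP[_ c0].
  by field; rewrite h0 c0.
have [t tE] := Kcl n (fun i => sec_in_K (c i * b ^+ (n - i.+1))) n0.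
have [w wE] := @integral_sec t n (fun i => c i * b ^+ (n - i.+1)) tE; rewrite -wE in tE.
exists (E w / E b).
have {}tE : w ^+ n = \sum_(i < n) (c i * b ^+ (n - i.+1)) * w ^+ i.
  apply: sec_in_K_inj; rewrite rmorphXn tE rmorph_sum; apply: eq_bigr => i _.
  by rewrite [RHS]rmorphM [sec_in_K (w ^+ i)]rmorphXn.
rewrite exprMn -rmorphXn tE rmorph_sum mulr_suml; apply: eq_bigr => i _.
rewrite cE // !rmorphM !rmorphXn exprMn exprVn.
have -> : E b ^+ n = E b ^+ (n - i.+1) * E b * E b ^+ i.
  by rewrite -exprSr -exprD subnSK // subnK // ltnW.
move: b0; move: (E b) (E w) (E (c i)) => u v t0 u0.
by rewrite exprVn; field; rewrite u0 !expf_neq0.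
Qed.

(** The point [y] is an ideal maximal among those that contain the prime of [x] and no power of [f].
    Its residue field is integral over a finitely generated ring with one element inverted, so
    Zariski's lemma descends to the integers. *)
Lemma specialization (Ufg : fg_ring (sec U)) (x : X) (Ux : U (pi x))
    (f : sec (W U)) :
  @ev X (W U) x Ux f != 0 ->
  exists (y : X) (Uy : U (pi y)),
    [/\ forall s, @ev X (W U) x Ux s = 0 -> @ev X (W U) y Uy s = 0,
        @ev X (W U) y Uy f != 0 &
        exists p (pk : p \in [pchar (kappa y)]),
          integralRange (prime_field_morph pk)].
Proof.
move=> f0; have Waff := nrm_affine X Uaff.
have [||n [np qn nf nmax]] := @exists_maximal_avoiding _ (@vanishing X (W U) x Ux) f.
- split; first exact: rmorph0.
    by move=> a b; rewrite /vanishing /= => a0 b0; rewrite rmorphD a0 b0 addr0.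
  by move=> a b; rewrite /vanishing /= => b0; rewrite rmorphM b0 mulr0.
- move=> i; rewrite /vanishing /= rmorphXn => h.
  by have := expf_neq0 i f0; rewrite h eqxx.
have [/(_ n np)[y [Uy yn]] _ _ _] := Waff.
pose E := @ev X (W U) y Uy.
have nE s : n s <-> E s = 0 by rewrite -yn.
have Ef0 : E f != 0 by apply/eqP => /nE h; apply: (nf 1%N); rewrite expr1.
exists y, Uy; split=> //; first by move=> s /qn/nE.
pose r : {rmorphism sec U -> kappa y} := E \o mor_sec pi U.
have [D [rho rhoE]] := nontrivial_source r.
have Eint s : integralOver rho (E s).
  have [m [a am]] := sec_integral s.
  apply: (@integral_eqn _ _ rho (E s) m (fun i => r (a i))) => [i _|].
    have : range rho (r (a i)) by rewrite rhoE; exists (a i).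
    by move=> [d _ <-]; exact: integral_id.
  rewrite -[RHS](rmorph0 E) -am rmorphD rmorphXn rmorph_sum; congr (_ + _).
  by apply: eq_bigr => i _; rewrite rmorphM rmorphXn.
(* The residue field needs [f] inverted, but [f] does not come from [U]; the constant [c], with
   [c / f] integral, replaces it. *)
have [c [c0 cint]] := integral_div_const Ef0 (Eint f).
have loc z : exists i, integralOver rho (rho c ^+ i * z).
  have [a [b [b0 ->]]] := @ev_fraction X (W U) y Uy z Waff.
  have nb : ~ n b by move/nE => h; move: b0; rewrite h eqxx.
  have [i [d [m [/nE m0 fi]]]] := nmax b nb.
  have fiE : E f ^+ i = E d * E b by rewrite -rmorphXn fi rmorphD m0 add0r rmorphM.
  exists i; have -> : rho c ^+ i * (E a / E b) = (rho c / E f) ^+ i * E (d * a).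
    have d0 : E d != 0.
      have : E f ^+ i != 0 by rewrite expf_neq0.
      by rewrite fiE mulf_eq0 => /norP[].
    by rewrite rmorphM exprMn exprVn fiE; field; rewrite d0 b0.
  by apply: integral_mul => //; exact: integral_expr.
have [gens gensP] := Ufg.
pose S := adjoin (map r gens) (intr : {rmorphism int -> kappa y}).
have rS : range rho `<=` S.
  rewrite rhoE => _ [a _ <-].
  have [S1 SB SM] := adjoin_subring (map r gens) (intr : {rmorphism int -> kappa y}).
  suff : a \in [pred a | `[< S (r a) >]] by move/asboolP.
  apply: gensP; first split.
  - by apply/asboolP; rewrite rmorph1.
  - by move=> u v /asboolP hu /asboolP hv; apply/asboolP; rewrite rmorphB; exact: SB.
  - by move=> u v /asboolP hu /asboolP hv; apply/asboolP; rewrite rmorphM; exact: SM.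
  by move=> u hu; apply/asboolP; apply: adjoin_mem; exact: map_f.
have [||d [d0 dl]] := @adjoin_zariski _ (map r gens) _
  (intr : {rmorphism int -> kappa y}) (rho c) _ c0.
- by apply: rS; exists c.
- move=> z; have [i hi] := loc z; exists i.
  exact: sub_integral_over rS (integralOver_range hi).
have [p pk] := locally_integral_pchar d0 dl.
exists p, pk; exact: locally_integral_prime_field d0 dl.
Qed.

End AffinePiece.
End Normalization.

(** * Density and closedness *)

Section UnitChar.
Variables (R : realType) (k : fieldType) (P : unit_char R k).

Lemma uchar_1 : P 1 = 1. Proof. by have [] := uchar_mul P. Qed.

Lemma uchar_M a b : P (a * b) = P a * P b. Proof. by have [] := uchar_mul P. Qed.

Lemma uchar_X a n : P (a ^+ n) = P a ^+ n.
Proof. by elim: n => [|n IH]; rewrite ?expr0 ?uchar_1 // !exprS uchar_M IH. Qed.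

Lemma uchar_prod (I : finType) (F : I -> k) : P (\prod_i F i) = \prod_i P (F i).
Proof. by apply: (big_morph P uchar_M uchar_1). Qed.

Lemma uchar_neq0 a : (P a != 0) = (a != 0).
Proof.
have [->|a0] := eqVneq a 0; first by rewrite uchar0 eqxx.
apply/eqP => Pa; have /eqP := uchar_1.
by rewrite -(divff a0) uchar_M Pa mul0r eq_sym oner_eq0.
Qed.

Lemma uchar_V a : P a^-1 = (P a)^-1.
Proof.
have [->|a0] := eqVneq a 0; first by rewrite invr0 uchar0 invr0.
apply: (mulfI (_ : P a != 0)); first by rewrite uchar_neq0.
by rewrite -uchar_M !divff ?uchar_neq0 ?uchar_1.
Qed.

Lemma uchar_torsion a d : (0 < d)%N -> a ^+ d = 1 -> `|P a| = 1.
Proof.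
move=> d0 ad; apply/eqP; rewrite -(@pexpr_eq1 _ _ d) // -normrX -uchar_X ad.
by rewrite uchar_1 normr1.
Qed.

End UnitChar.

Lemma finite_roots_of_unity (k : fieldType) n : GRing.closed_field_axiom k ->
  (0 < n)%N -> finite_set [set z : k | z ^+ n = 1].
Proof.
move=> /closedFieldType_of[F ->] n0.
have [r] := closed_field_poly_normal ('X^n - 1 : {poly F}).
rewrite lead_coefDl ?size_polyXn ?size_polyN ?size_poly1 // lead_coefXn scale1r => rE.
apply: (@sub_finite_set _ _ [set` r]) => [z /= zn|]; last exact: finite_seq.
by rewrite /= -root_prod_XsubC -rE rootE !hornerE zn subrr.
Qed.

(** * Approximating a unitary character by a periodic one *)

Section Approximation.
Variable R : realType.
Context {X0 : scheme} {eta0 : X0} {K : fieldType}.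
Context {iota : {rmorphism kappa eta0 -> K}}.
Variable X : normalization iota.
Local Notation pi := (nrm_pi X).
Local Notation W := (Defs.preim (mor_cont (nrm_pi X))).
Local Notation eta := (nrm_eta X).
Hypotheses (eta0G : is_generic_point eta0) (Kcl : is_algebraic_closure iota).

Lemma periodic_approx (U : opens X0) (a : dotX R X) (Ua : U (pi (dpt a)))
    (s : seq (sec (W U))) (k : nat) :
  is_affine U -> fg_ring (sec U) -> dot_S1 a ->
  exists (b : dotX R X) (Ub : U (pi (dpt b))), dot_per b /\
    forall r, r \in s ->
      `|dchar b (@ev X (W U) _ Ub r) - dchar a (@ev X (W U) _ Ua r)| < k.+1%:R^-1.
Proof.
move=> Uaff Ufg aS1; case: a Ua aS1 => x Q /= Ux QS1.
have U0 : U eta0 := generic_mem eta0G (oset_open U) Ux.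
have U1 : U (pi eta) := generic_mem (nrm_generic X) (oset_open (W U)) Ux.
pose ex := @ev X (W U) x Ux.
pose s' := [seq r <- s | ex r != 0]; pose n := (size s').+1.
pose r (i : 'I_n) := nth 1 (1 :: s') i.
have exr i : ex (r i) != 0.
  case: i => -[|i] /= ltin; first by rewrite /r /= rmorph1 oner_neq0.
  have : nth 1 s' i \in s' by rewrite mem_nth.
  by rewrite mem_filter => /andP[].
have [M HM] := @power_approx (R[i] : numClosedFieldType) n k.+1 isT.
(* The first entry of [r] is [1], which pins down the common value of the terms
   that [power_approx] makes nearly equal. *)
pose word (w : {ffun 'I_M -> 'I_n}) := \prod_t r (w t).
(* Nonvanishing of [f] at [y] keeps all [r i] nonzero and excludes new relations between words of
   length [M]. *)
pose f := \prod_i r i *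
  \prod_(w : {ffun 'I_M -> 'I_n} * {ffun 'I_M -> 'I_n} |
          ex (word w.1 - word w.2) != 0)
    (word w.1 - word w.2).
have f0 : ex f != 0.
  by rewrite rmorphM !rmorph_prod mulf_neq0 //; apply/prodf_neq0 => // i _; exact: exr.
have [y [Uy [xy fy [p [pk kint]]]]] := specialization Uaff U0 U1 Ufg f0.
pose ey := @ev X (W U) y Uy; have [kcl _] := Kcl.
have ycl : GRing.closed_field_axiom (kappa y) := kappa_closed Uaff U0 U1 kcl Uy.
have tor (z : kappa y) : z != 0 -> exists2 d, (0 < d)%N & z ^+ d = 1.
  by move=> z0; exact: prime_field_torsion z0 (kint z).
have [om omI] := injective_unit_char R ycl pk tor.
move: fy; rewrite -/ey /f rmorphM mulf_eq0 negb_or !rmorph_prod => /andP[].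
move=> /prodf_neq0 eyr /prodf_neq0 eyw.
pose c i : Cplx R := Q (ex (r i)); pose u i : Cplx R := om (ey (r i)).
have c1 i : `|c i| = 1 by apply: QS1; exact: exr.
have /choice[d dP] : forall i, exists d, (0 < d)%N /\ ey (r i) ^+ d = 1.
  by move=> i; have [d d0 hd] := tor _ (eyr i isT); exists d.
pose q := (\prod_i d i)%N.
have q0 : (0 < q)%N by rewrite prodn_gt0 // => i; have [] := dP i.
have uq i : u i ^+ q = 1.
  have [d0 hd] := dP i.
  by rewrite /u -uchar_X /q (bigD1 i) //= exprM hd expr1n uchar_1.
have [w w'|j jP] := HM c u q q0 c1 uq.
  (* Products equal under [om] are equal in [kappa y] by injectivity, then at [x] by the choice of
     [f], and then under [Q]. *)
  move=> h; have exy : ey (word w) = ey (word w').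
    have w'0 : ey (word w') != 0.
      by rewrite rmorph_prod; apply/prodf_neq0 => i _; exact: eyr.
    rewrite -[LHS](divfK w'0) [X in X * _](_ : _ = 1) ?mul1r //.
    apply: omI; rewrite uchar_M uchar_V !rmorph_prod !uchar_prod h divff //.
    by apply/prodf_neq0 => i _; rewrite uchar_neq0; exact: eyr.
  have : ex (word w - word w') == 0.
    apply: contraT => hx; have := eyw (w, w') hx.
    by rewrite /= rmorphB exy subrr eqxx.
  rewrite rmorphB subr_eq0 => /eqP /(congr1 Q).
  by rewrite !rmorph_prod !uchar_prod.
pose nu : pos_nat := exist _ j.+1 (ltn0Sn j).
exists (DotPt (uchar_pow nu om)), Uy; split.
  split.
    exists p; first exact: pcharf_prime pk.
    by exists (prime_field_morph pk); split.
  apply: sub_finite_set (finite_roots_of_unity ycl (ltn0Sn j)) => z /= [_].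
  exact: omI.
(* A section vanishing at [x] vanishes at [y] too, so both characters take the value 0 on it. *)
move=> t ts /=; have [t0|t0] := eqVneq (ex t) 0.
  by rewrite -/ex -/ey t0 (xy _ t0) expr0n /= !uchar0 subrr normr0 invr_gt0 ltr0n.
have ts' : t \in s' by rewrite mem_filter t0.
have lt_t : ((index t s').+1 < n)%N by rewrite ltnS index_mem.
have rt : r (Ordinal lt_t) = t by rewrite /r /= nth_index.
have := jP (Ordinal lt_t) ord0.
have r0 : r ord0 = 1 by [].
rewrite /c /u rt r0 !rmorph1 !uchar_1 expr1n rmorph1 mulr1 uchar_X.
have ct : `|Q (ex t)| = 1 by exact: QS1.
set z := om _; rewrite -[X in X < _ -> _]mul1r -{1}ct -normrM mulrBr mulr1 mulrA.
by rewrite (unit_norm_conj ct) mul1r.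
Qed.

End Approximation.

(** * The topology of pointwise convergence *)

Section Pointwise.
Variable R : realType.

Lemma cplx_archi (e : Cplx R) : 0 < e -> exists k : nat, k.+1%:R^-1 < e.
Proof.
case: e => a b; rewrite ltcE /= => /andP[/eqP-> a0].
exists (Num.truncn a^-1).
have h : a^-1 < (Num.truncn a^-1).+1%:R by apply: truncnS_gt.
have -> : (((Num.truncn a^-1).+1%:R)^-1 : R[i]) = (((Num.truncn a^-1).+1%:R)^-1 : R)%:C%C.
  by rewrite fmorphV rmorph_nat.
rewrite ltcE /= eqxx /= invf_plt ?posrE //.
Qed.

Lemma ptws_nbhs (T : choiceType) (g : T -> Cplx R) (V : set {ptws T -> Cplx R}) :
  open V -> V g -> exists (s : seq T) (k : nat), forall h : T -> Cplx R,
    (forall r, r \in s -> `|h r - g r| < k.+1%:R^-1) -> V h.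
Proof.
move=> oV Vg.
(* The sets containing a box around [g] on finitely many coordinates form a filter; its convergence
   to [g] is tested one coordinate at a time. *)
pose F : set_system {ptws T -> Cplx R} :=
  [set A | exists (s : seq T) (k : nat), forall h : T -> Cplx R,
    (forall r, r \in s -> `|h r - g r| < k.+1%:R^-1) -> A h].
have FF : Filter F.
  split.
  - by exists [::], 0%N.
  - move=> A B [s [k hA]] [t [l hB]]; exists (s ++ t), (maxn k l) => h hst.
    have le (a b : nat) : (a <= b)%N -> (b.+1%:R^-1 : Cplx R) <= a.+1%:R^-1.
      by move=> ab; rewrite lef_pV2 ?posrE // ler_nat ltnS.
    split; [apply: hA|apply: hB] => r rs.
      by apply: lt_le_trans (hst r _) (le _ _ (leq_maxl _ _)); rewrite mem_cat rs.
    by apply: lt_le_trans (hst r _) (le _ _ (leq_maxr _ _)); rewrite mem_cat rs orbT.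
  - by move=> A B AB [s [k h]]; exists s, k => u /h /AB.
have Fg : F --> (g : {ptws T -> Cplx R}).
  apply/cvg_sup => i U [V' [[B] oB <-] Bg VU].
  have [e e0 be] : exists2 e : Cplx R, 0 < e & ball (g i) e `<=` B.
    by have /nbhs_ballP[e e0 h] := open_nbhs_nbhs (conj oB Bg); exists e.
  have [k ke] := cplx_archi e0.
  exists [:: i], k => h hi; apply: VU; apply: be.
  rewrite -ball_normE /= distrC; apply: lt_trans ke; apply: hi.
  by rewrite mem_head.
exact: (Fg V (open_nbhs_nbhs (conj oV Vg))).
Qed.

Lemma ptws_eval_open (T : choiceType) (t : T) (B : set (Cplx R)) : open B ->
  open [set h : {ptws T -> Cplx R} | B (h t)].
Proof.
move=> oB; rewrite openE => f Bf.
have /cvg_sup/(_ t) h : f --> (f : {ptws T -> Cplx R}) by exact: cvg_id.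
by apply: h; exists (fun g => B (g t)) => //; split=> //; exists B.
Qed.

End Pointwise.

(** * Unitary points in the inductive limit and in its Galois quotient *)

Section Topology.
Variable R : realType.
Context {X0 : scheme} {eta0 : X0} {K : fieldType}.
Context {iota : {rmorphism kappa eta0 -> K}}.
Variable X : normalization iota.
Local Notation pi := (nrm_pi X).
Local Notation W := (Defs.preim (mor_cont (nrm_pi X))).
Local Notation eta := (nrm_eta X).

(** Elements of [kappa x] are quotients of values of functions over [U]. A character is therefore
    not unitary exactly when it sends one such value outside 0 and the unit circle, which is an open
    condition. *)
Lemma not_S1_open : dot_open (~` (@dot_S1 R _ _ _ _ X)).
Proof.
have closed1 (c : Cplx R) : closed [set c].
  exact: accessible_closed_set1 (hausdorff_accessible (@norm_hausdorff _ _)) _.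
move=> U Uaff; have Waff := nrm_affine X Uaff.
pose B : set (Cplx R) := [set c | c != 0 /\ `|c| != 1].
have oB : open B.
  have -> : B = ~` ([set 0] `|` [set c | `|c| = 1]).
    apply/seteqP; split=> c /=.
      by move=> [/eqP c0 /eqP c1] [].
    by move=> /not_orP[/eqP c0 /eqP c1].
  apply: closed_openC; apply: closedU; first exact: closed1.
  apply: (@closed_comp _ _ (fun c : Cplx R => `|c|) [set 1]).
    by move=> c _; exact: norm_continuous.
  exact: closed1.
exists (\bigcup_r [set h : {ptws sec (W U) -> Cplx R} | B (h r)]); split.
  by apply: bigcup_open => r _; exact: ptws_eval_open.
case=> x P /= Ux; split; last first.
  move=> [r _ [/= Pr0 Pr1]] PS1; move/eqP: Pr1; apply; apply: PS1.
  by rewrite -(uchar_neq0 P).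
move=> nS1; apply: contrapT => no; apply: nS1 => z z0 /=.
have S1 r : @ev X (W U) x Ux r != 0 -> `|P (@ev X (W U) x Ux r)| = 1.
  move=> r0; apply: contrapT => /eqP r1; apply: no; exists r => //; split=> //=.
  by rewrite uchar_neq0.
have [a [b [b0 zE]]] := @ev_fraction X (W U) x Ux z Waff.
have a0 : @ev X (W U) x Ux a != 0.
  by apply: contraNneq z0 => h; rewrite zE h mul0r.
by rewrite zE uchar_M uchar_V normrM normfV !S1 // invr1 mulr1.
Qed.

Lemma dot_frob_S1 (nu : pos_nat) (a : dotX R X) :
  dot_S1 (X := X) (dot_frob nu a) <-> dot_S1 a.
Proof.
split=> h z z0 /=; last by apply: h; rewrite expf_neq0.
have := h z z0; rewrite /= uchar_X normrX => /eqP.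
by rewrite pexpr_eq1 // ?(valP nu) // => /eqP.
Qed.

(** Each [F_nu] preserves and reflects unitarity, so all representatives of a class agree. *)
Lemma to_checkX_S1 (nu : pos_nat) (a : dotX R X) :
  checkX_S1 (to_checkX nu a) <-> dot_S1 a.
Proof.
split=> [[mu [b [bS1 e]]]|aS1]; last by exists nu, a.
have /asboolP[m [n [_ /= emn]]] : colim_rel (existT (fun=> dotX R X) nu a) (existT _ mu b).
  exact/(@eqmodP _ (colim_equiv R X)).
by apply/(dot_frob_S1 m); rewrite emn; apply/dot_frob_S1.
Qed.

Lemma checkX_openP (O : set (checkX R X)) :
  open O <-> forall nu, dot_open (to_checkX nu @^-1` O).
Proof. exact: sigT_openP. Qed.

Lemma checkX_S1_closed : closed (@checkX_S1 R _ _ _ _ X).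
Proof.
rewrite -openC; apply/checkX_openP => nu.
have -> : to_checkX nu @^-1` (~` (@checkX_S1 R _ _ _ _ X)) = ~` (@dot_S1 R _ _ _ _ X).
  by apply/seteqP; split=> a /=; apply: contra_not => /to_checkX_S1.
exact: not_S1_open.
Qed.

Lemma per_S1 : @dot_per R _ _ _ _ X `<=` @dot_S1 R _ _ _ _ X.
Proof.
move=> a [[p pp [f [_ fint]]] _] z z0.
have [d d0 zd] := prime_field_torsion z0 (fint z).
exact: uchar_torsion d0 zd.
Qed.

Lemma checkX_per_S1 : @checkX_per R _ _ _ _ X `<=` @checkX_S1 R _ _ _ _ X.
Proof. by move=> _ [nu [a [/per_S1 aS1 ->]]]; exists nu, a. Qed.

Section Galois.
Hypothesis eta0G : is_generic_point eta0.

(** The inverse of [sigma] carries a section, viewed in [K], to an element integral over the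
    functions on [U], hence to a section. So all values of sections at [x] are reached, and
    [kappa x] consists of their quotients. This lets the Galois action reflect unitarity. *)
Lemma galois_mor_kappa_surj (sigma : {rmorphism K -> K}) (g : morphism X X) (x : X)
    (z : kappa x) :
  is_galois (iota := iota) sigma -> is_galois_action sigma g ->
  exists z', mor_kappa g x z' = z.
Proof.
move=> [sbij siota] [gpi gsec].
have [U [Ux Uaff]] := sch_affine (pi x); have Waff := nrm_affine X Uaff.
have U0 : U eta0 := generic_mem eta0G (oset_open U) Ux.
have U1 : U (pi eta) := generic_mem (nrm_generic X) (oset_open (W U)) Ux.
have Wg : W U `<=` Defs.preim (mor_cont g) (W U).
  by move=> y; rewrite /Defs.preim /= gpi.
have lift t : exists s : sec (W U), t = res Wg (mor_sec g (W U) s).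
  have [n [a tE]] := sec_integral Uaff U0 U1 t.
  have [tau sK tK] := sbij.
  pose w := tau (sec_in_K U1 t).
  have wE : w ^+ n = \sum_(i < n) sec_in_K U1 (mor_sec pi U (- a i)) * w ^+ i.
    apply: (fmorph_inj sigma); rewrite rmorphXn tK rmorph_sum.
    have /eqP := congr1 (sec_in_K U1) tE.
    rewrite rmorphD rmorphXn rmorph_sum rmorph0 addr_eq0 => /eqP ->.
    rewrite -sumrN; apply: eq_bigr => i _.
    rewrite (sec_in_K_mor_sec U0 U1) !(rmorphM sigma) (rmorphXn sigma) tK siota.
    rewrite rmorphN [iota (- _)]rmorphN -(sec_in_K_mor_sec U0 U1) mulNr.
    by rewrite [sec_in_K U1 (_ * _)]rmorphM [sec_in_K U1 (t ^+ i)]rmorphXn.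
  have [s sE] := @integral_sec _ _ _ _ X U Uaff U0 U1 w n (fun i => mor_sec pi U (- a i)) wE.
  exists s; apply: (sec_in_K_inj Uaff (U1 := U1)).
  rewrite [RHS]/= ev_res (gsec (W U) U1) -[nrm_theta X _]/(sec_in_K U1 s) sE.
  by rewrite /w tK.
have im t : exists z', mor_kappa g x z' = @ev X (W U) x Ux t.
  by have [s ->] := lift t; rewrite ev_res mor_ev; eexists.
have [a [b [b0 ->]]] := @ev_fraction X (W U) x Ux z Waff.
have [a' <-] := im a; have [b' <-] := im b.
by exists (a' / b'); rewrite fmorph_div.
Qed.

Lemma dot_act_S1 (sigma : {rmorphism K -> K}) (g : morphism X X) (a : dotX R X) :
  is_galois (iota := iota) sigma -> is_galois_action sigma g ->
  dot_S1 (X := X) (dot_act g a) <-> dot_S1 a.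
Proof.
move=> sG gG; split=> h z z0; last by apply: h; rewrite fmorph_eq0.
have [z' zE] := galois_mor_kappa_surj z sG gG.
rewrite -zE; apply: h.
by apply: contraNneq z0 => z'0; rewrite -zE z'0 rmorph0.
Qed.

(** Unitarity is constant along every Galois step, so the unitary locus is saturated and its
    closedness can be tested upstairs. *)
Lemma to_checkX0_S1 (u : checkX R X) :
  checkX0_S1 (to_checkX0 u) <-> checkX_S1 u.
Proof.
split=> [[v vS1 vu]|uS1]; last by exists u.
have /asboolP uv : galois_rel v u.
  exact/(@eqmodP _ (galois_equiv R X)).
suff: checkX_S1 v <-> checkX_S1 u by move=> [+ _]; apply.
elim: uv => {u v vS1 vu} [u v|//|u v _ [h h']|u v w _ [a b] _ [c d]]; last first.
- by split=> [/a/c|/d/b].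
- by [].
move=> [sigma [g [sG gG [nu [a [-> ->]]]]]].
split=> /to_checkX_S1 h; apply/to_checkX_S1; first exact/(dot_act_S1 a sG gG).
by apply/(dot_act_S1 a sG gG).
Qed.

Lemma checkX0_S1_closed : closed (@checkX0_S1 R _ _ _ _ X).
Proof.
rewrite -openC.
suff: open (~` (@checkX_S1 R _ _ _ _ X)).
  congr open; apply/seteqP; split=> u /=; by apply: contra_not => /to_checkX0_S1.
by rewrite openC; exact: checkX_S1_closed.
Qed.

End Galois.

Lemma to_checkX0_continuous : continuous (@to_checkX0 R _ _ _ _ X).
Proof. exact: pi_continuous. Qed.

(** A neighbourhood is read at the level [nu] of the given point and on one affine chart of finite
    type, where it contains a box on finitely many functions. *)
Lemma checkX_S1_dense (eta0G : is_generic_point eta0)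
    (X0ft : finite_type_Z X0) (Kcl : is_algebraic_closure iota) :
  @checkX_S1 R _ _ _ _ X `<=` closure (@checkX_per R _ _ _ _ X).
Proof.
move=> u [nu [a [aS1 ->]]] N; rewrite nbhsE => -[A [oA Aa] AN].
have [n [V [Vaff Vcov]]] := X0ft.
have [i Ui] := Vcov (pi (dpt a)); have [Uaff Ufg] := Vaff i.
have /(_ nu _ Uaff)[P [oP PE]] := iffLR (checkX_openP A) oA.
have [s [k hsk]] := ptws_nbhs oP (iffLR (PE a Ui) Aa).
have [b [Ub [bper bs]]] := periodic_approx eta0G Kcl Ui s k Uaff Ufg aS1.
exists (to_checkX nu b); split; first by exists nu, b.
by apply: AN; apply/(PE b Ub); exact: hsk.
Qed.

End Topology.

Theorem theorem8p2 (R : realType) (X0 : scheme) (eta0 : X0) (K : fieldType)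
    (iota : {rmorphism kappa eta0 -> K}) (X : normalization iota)
    (X0_integral : is_integral X0) (eta0_generic : is_generic_point eta0)
    (X0_normal : is_normal eta0) (X0_finite_type : finite_type_Z X0)
    (K_closure : is_algebraic_closure iota)
    (claim : krull_dim_ge X0 2 \/
             (krull_dim_eq X0 1 /\ exists p, p \in [pchar (kappa eta0)]%R) ->
             reduction_orders_claim) :
  closure (@checkX_per R X0 eta0 K iota X) = @checkX_S1 R X0 eta0 K iota X /\
  closure (@checkX0_per R X0 eta0 K iota X) = @checkX0_S1 R X0 eta0 K iota X.
Proof.
have dense := checkX_S1_dense (R := R) (X := X) eta0_generic X0_finite_type K_closure.
split; apply/seteqP; split.
- by apply: subset_trans (closureS _) (@checkX_S1_closed _ _ _ _ _ _); exact: checkX_per_S1.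
- exact: dense.
- apply: subset_trans (closureS _) (checkX0_S1_closed eta0_generic).
  by move=> _ [u /checkX_per_S1 uS1 <-]; exists u.
(* Density passes to the quotient because the preimage of a neighbourhood is a neighbourhood. *)
- move=> _ [u /dense uper <-] B Bu.
  have [v [vper Bv]] := uper _ (to_checkX0_continuous Bu).
  by exists (to_checkX0 v); split=> //; exists v.
Qed.
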